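(* Let $X$ be a compact interval, $m$ normalized Lebesgue measure on $X$, $\Omega$ a measurable space, and $\{T_\omega\}_{\omega\in\Omega}$ a family of maps $T_\omega\colon X\to X$ as described in the context, with inverse branches $g_{z,\omega}$, $z\in Z$. Let $\{\mathbb{P}_\epsilon\}_{\epsilon\in V}$ be a family of probability measures on $\Omega$, $V$ a neighbourhood of $0$, and let $L_{\mathbb{P}_\epsilon}$ be the associated random transfer operators. Assume: (B) for $\epsilon\in V$ the operators $L_{\mathbb{P}_\epsilon}$ admit a uniform spectral gap on $C^1(X)$, and the random system $(\Omega,\{T_\omega\},\mathbb{P}_\epsilon)$ admits a unique stationary density $h_\epsilon\in C^2(X)$; (B1) for $\Phi=h_0$, the partial derivatives $\partial_\epsilon\psi_z(\epsilon,x)$, $\partial_x\psi_z(\epsilon,x)$, $\partial_x\partial_\epsilon\psi_z(\epsilon,x)$, $\partial_\epsilon\partial_x\psi_z(\epsilon,x)$ exist and are jointly continuous in $(\epsilon,x)\in V\times X$, and for $i=0,1$, $\sum_{z\in Z}\sup_{\epsilon\in V}\sup_{x\in X}|\partial_\epsilon\psi_z^{(i)}(\epsilon,x)|<\infty$, where $\psi_z^{(0)}=\psi_z$, $\psi_z^{(1)}=\partial_x\psi_z$; (B2) for every $\Phi\in C^1(X)$, $\psi_z(\epsilon,x)$ and $\partial_x\psi_z(\epsilon,x)$ exist and are jointly continuous, and for $i=0,1$, $\sum_{z\in Z}\sup_{\epsilon\in V}\sup_{x\in X}|\psi_z^{(i)}(\epsilon,x)|<\infty$. Then there exists $h^*\in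 C^1(X)$ such that $\left\|\frac{h_\epsilon-h_0}{\epsilon}-h^*\right\|_{C^1}\to 0$ as $\epsilon\to0$, and $$h^*=(I-L_{\mathbb{P}_0})^{-1}\,\partial_\epsilon L_{\mathbb{P}_\epsilon}h_0\big|_{\epsilon=0},\qquad \partial_\epsilon L_{\mathbb{P}_\epsilon}h_0\big|_{\epsilon=0}=\partial_\epsilon\sum_{z\in Z}\int_\Omega [h_0\circ g_{z,\omega}\,|g_{z,\omega}'|]\,d\mathbb{P}_\epsilon(\omega)\Big|_{\epsilon=0}.$$
   Context: For each $\omega\in\Omega$ there is a finite or countable set $Z$ (common to all $\omega$, with empty branches allowed and ignored in sums) and a partition mod $0$ of $X$ into open intervals $X_{z,\omega}$, $z\in Z$, such that $T_\omega|_{X_{z,\omega}}$ is $C^3$ and onto $X$; $g_{z,\omega}\colon X\to X_{z,\omega}$ is its inverse. The transfer operator of $T_\omega$ is $L_{T_\omega}\Phi=\sum_{z\in Z}\Phi\circ g_{z,\omega}|g_{z,\omega}'|$, and $L_{\mathbb{P}}\Phi=\int_\Omega L_{T_\omega}\Phi\,d\mathbb{P}(\omega)$. A stationary density is $h\in L^1(m)$, $h\ge0$, $\int h\,dm=1$, with $L_{\mathbb{P}}h=h$ (density of an absolutely continuous measure $\mu$ with $\int\int\phi\circ T_\omega\,d\mathbb{P}\,d\mu=\int\phi\,d\mu$ for bounded measurable $\phi$). For $\Phi\in L^1(X)$ and $z\in Z$, $\psi_z(\epsilon,x)=\int_\Omega[\Phi\circ g_{z,\omega}|g_{z,\omega}'|](x)\,d\mathbb{P}_\epsilon(\omega)$.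 A family of operators $L_\epsilon$ has a uniform spectral gap on a Banach space $\mathcal{B}$ of functions if there are $\theta\in(0,1)$ and $C>0$ independent of $\epsilon$ such that $\|L_\epsilon^n\phi\|_{\mathcal B}\le C\theta^n\|\phi\|_{\mathcal B}$ for all $n\ge1$ and all $\phi\in\mathcal{B}$ with $\int\phi\,dm=0$. $\|f\|_{C^1}=\|f\|_\infty+\|f'\|_\infty$. The inverse $(I-L_{\mathbb{P}_0})^{-1}$ is taken on zero-average $C^1$ functions. *)

(* Defs.v *)
From HB Require Import structures.
From mathcomp Require Import all_boot all_order all_algebra.
From mathcomp Require Import all_classical all_reals all_analysis.
Set Implicit Arguments. Unset Strict Implicit. Unset Printing Implicit Defensive.
Import Order.TTheory GRing.Theory Num.Theory.
Import numFieldNormedType.Exports.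
Local Open Scope classical_set_scope.
Local Open Scope ring_scope.

Section Defs.
Context (R : realType).

Definition has_deriv_in (a b : R) (f : R -> R) (x l : R) : Prop :=
  (fun y => (f y - f x) / (y - x)) @
     within [set y | a <= y <= b /\ y != x] (nbhs x) --> l.

Definition isC1 (a b : R) (f df : R -> R) : Prop :=
  (forall x, a <= x <= b -> has_deriv_in a b f x (df x)) /\
  {within `[a, b], continuous df}.

Definition supnorm (a b : R) (f : R -> R) : R :=
  sup [set `|f x| | x in `[a, b]%classic].

Definition C1norm (a b : R) (f df : R -> R) : R :=
  supnorm a b f + supnorm a b df.

Definition mint (a b : R) (f : R -> R) : R :=
  (\int[@lebesgue_measure R]_(x in `[a, b]) f x) / (b - a).

Context d (Omega : measurableType d).

(* one branch term  [Phi o g_{z,w}] |g_{z,w}'|(x); empty branches give 0 *)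
Definition bterm (active : nat -> Omega -> bool) (g dg : nat -> Omega -> R -> R)
  (Phi : R -> R) (z : nat) (w : Omega) (x : R) : R :=
  if active z w then Phi (g z w x) * `|dg z w x| else 0.

Definition LT active (g dg : nat -> Omega -> R -> R) (w : Omega)
  (Phi : R -> R) : R -> R :=
  fun x => limn (fun n => \sum_(0 <= z < n) bterm active g dg Phi z w x).

Definition LP active (g dg : nat -> Omega -> R -> R) (P : probability Omega R)
  (Phi : R -> R) : R -> R :=
  fun x => \int[P]_(w in setT) LT active g dg w Phi x.

Definition psi active (g dg : nat -> Omega -> R -> R) (P : R -> probability Omega R)
  (Phi : R -> R) (z : nat) (eps x : R) : R :=
  \int[P eps]_(w in setT) bterm active g dg Phi z w x.

Definition branch_system (a b : R) (T : Omega -> R -> R)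
  (active : nat -> Omega -> bool) (lo hi : nat -> Omega -> R)
  (g dg : nat -> Omega -> R -> R) : Prop :=
  forall w : Omega,
  [/\ forall x, a <= x <= b -> a <= T w x <= b,
      forall z, active z w -> a <= lo z w /\ lo z w < hi z w /\ hi z w <= b,
      forall z z', active z w -> active z' w -> z != z' ->
        `]lo z w, hi z w[%classic `&` `]lo z' w, hi z' w[%classic = set0,
      @lebesgue_measure R
        (`[a, b]%classic `\` \bigcup_(z in [set z | active z w]) `]lo z w, hi z w[%classic)
        = 0%E &
      forall z, active z w ->
      [/\ exists T1 T2 T3 : R -> R,
            [/\ forall x, lo z w < x < hi z w -> is_derive x 1 (T w) (T1 x),
                forall x, lo z w < x < hi z w -> is_derive x 1 T1 (T2 x),
                forall x, lo z w < x < hi z w -> is_derive x 1 T2 (T3 x) &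
                {in `]lo z w, hi z w[%classic, continuous T3}],
          T w @` `]lo z w, hi z w[%classic = `]a, b[%classic,
          forall x, a <= x <= b -> lo z w <= g z w x <= hi z w,
          forall x, a < x < b -> T w (g z w x) = x /\ lo z w < g z w x < hi z w &
          forall y, lo z w < y < hi z w -> g z w (T w y) = y /\
          forall x, a <= x <= b -> has_deriv_in a b (g z w) x (dg z w x)]].

End Defs.

(* Main.v *)
(* Both densities are fixed points, so (I - L_e)(h_e - h_0) = (L_e - L_0) h_0.
   With q_e = (L_e - L_0) h_0 / e and u_e = (h_e - h_0) / e - hs, where hs solves
   (I - L_0) hs = D, this gives
     (I - L_e) u_e = (q_e - D) + (L_e - L_0) hs,
   and the uniform gap bounds the C1 norm of u_e by a constant times that of the
   right-hand side.  The first term tends to 0 in C1 by (B1): D is the C1 limit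
   of q_e, with derivative the sum of the d_e d_x psi_z, so that no symmetry of
   mixed derivatives is needed.  The second tends to 0 by (B2) and compactness.
   The interchange of sum and integral in L_e Phi = sum_z psi_z is dominated by
   the summability in (B2) for constant Phi. *)
Require Import Defs.
From HB Require Import structures.
From mathcomp Require Import all_boot all_order all_algebra.
From mathcomp Require Import all_classical all_reals all_analysis.
From mathcomp Require Import measurable_realfun ring lra.
Import Order.TTheory GRing.Theory Num.Theory.
Import numFieldNormedType.Exports.
Local Open Scope classical_set_scope.
Local Open Scope ring_scope.

(** The uniform gap allows [I - L_e] to be inverted at the running parameter [e] instead of at 0,
    and this choice shapes the proof. With [L_e] on the left, the right-hand side involves only the
    two fixed functions [h 0] and [hs], so continuity of [e -> L_e f] in C1 for each fixed [f] is
    enough; neither an operator-norm estimate for [L_e - L_0] nor an a priori bound on [h e] enters.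
    Two kinds of bookkeeping remain. Functions are total on the reals while only [[a, b]] matters,
    so the operators must be shown to ignore values elsewhere; and a C1 function is a pair whose
    second component is a witness, so norms must be shown independent of the witness. Limits stay in
    C1 through one fact, closedness under uniform limits of pairs; it serves the Neumann series for
    [hs], the sums over branches and [D]. *)

(** * Derivatives and C1 functions on a closed interval *)

Lemma has_deriv_inP (R : realType) (a b : R) (f : R -> R) (x l : R) :
  has_deriv_in a b f x l <->
  (forall e, 0 < e -> exists2 r, 0 < r & forall y, a <= y <= b -> `|y - x| < r ->
     `|f y - f x - l * (y - x)| <= e * `|y - x|).
Proof.
have rew y e : y != x -> (`|l - (f y - f x) / (y - x)| <= e) =
    (`|f y - f x - l * (y - x)| <= e * `|y - x|).
  move=> yx; have yx0 : y - x != 0 by rewrite subr_eq0.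
  rewrite -(ler_pM2r (_ : 0 < `|y - x|)) ?normr_gt0// -normrM -normrN.
  by congr (`|_| <= _); field.
rewrite /has_deriv_in; split.
  move=> /cvgrPdist_le H e /H; rewrite near_withinE => /nbhs_ballP[r /= r0 Hr].
  exists r => // y yab yx; have [->|nyx] := eqVneq y x.
    by rewrite !subrr mulr0 subrr normr0 mulr0.
  by rewrite -rew//; apply: Hr => //=; rewrite /ball/= distrC.
move=> H; apply/cvgrPdist_le => e /H[r r0 Hr]; rewrite near_withinE.
apply/nbhs_ballP; exists r => //= y yx [yab nyx]; rewrite rew//.
by apply: Hr => //; rewrite distrC.
Qed.

(** The shape matches [has_deriv_inP], so at an interior point a derivative within [[a, b]] becomes
    a two-sided one merely by shrinking the radius. *)
Lemma is_derive1P (R : realType) (f : R -> R) (x l : R) :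
  is_derive x 1 f l <->
  (forall e, 0 < e -> exists2 r, 0 < r & forall y, `|y - x| < r ->
     `|f y - f x - l * (y - x)| <= e * `|y - x|).
Proof.
have rew k l' e : k != 0 -> (`|l' - k^-1 * (f (k * 1 + x) - f x)| <= e) =
    (`|f (k + x) - f x - l' * k| <= e * `|k|).
  move=> k0; rewrite mulr1 -(ler_pM2r (_ : 0 < `|k|)) ?normr_gt0// -normrM -normrN.
  by congr (`|_| <= _); field.
split.
  move=> [/cvg_ex[/= l' Hl'] El].
  have {El} <- : l' = l by rewrite -El /derive; apply/esym/cvg_lim.
  move: Hl' => /cvgrPdist_le H e /H /nbhs_ballP[r /= r0 Hr].
  exists r => // y yx; have [->|nyx] := eqVneq y x.
    by rewrite !subrr mulr0 subrr normr0 mulr0.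
  have yx0 : y - x != 0 by rewrite subr_eq0.
  have := Hr (y - x); rewrite /ball /= sub0r normrN => /(_ yx yx0).
  move=> Hk; have {}Hk : `|l' - (y - x)^-1 * (f ((y - x) * 1 + x) - f x)| <= e := Hk.
  by move: Hk; rewrite rew// subrK.
move=> H.
suff Hl : (fun h : R => h^-1 *: ((f \o shift x) (h *: (1 : R)) - f x)) @ 0^' --> l.
  split; first by apply/cvg_ex; exists l.
  by apply/cvg_lim.
apply/cvgrPdist_le => e /H[r r0 Hr]; apply/nbhs_ballP; exists r => //= k.
rewrite /ball /= sub0r normrN => kr k0.
change (`|l - k^-1 * (f (k * 1 + x) - f x)| <= e); rewrite rew//.
by have := Hr (k + x); rewrite addrK; apply.
Qed.

Lemma within_itv_continuousP (R : realType) (a b : R) (f : R -> R) :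
  {within `[a, b], continuous f} <->
  (forall x, a <= x <= b -> forall e, 0 < e -> exists2 r, 0 < r &
    forall y, a <= y <= b -> `|y - x| < r -> `|f y - f x| <= e).
Proof.
rewrite subspace_continuousP; split.
  move=> H x xab e e0; have /H : `[a, b]%classic x by rewrite /= in_itv.
  move=> /cvgrPdist_le/(_ _ e0); rewrite near_withinE => /nbhs_ballP[r /= r0 Hr].
  exists r => // y yab yx; rewrite distrC; apply: Hr; last by rewrite /= in_itv.
  by rewrite /ball /= distrC.
move=> H x; rewrite /= in_itv /= => xab; apply/cvgrPdist_le => e /(H _ xab)[r r0 Hr].
rewrite near_withinE; apply/nbhs_ballP; exists r => //= y yx.
by rewrite in_itv /= => yab; rewrite distrC; apply: Hr => //; rewrite distrC.
Qed.

Lemma has_deriv_in_cont (R : realType) (a b : R) (f df : R -> R) :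
  (forall x, a <= x <= b -> has_deriv_in a b f x (df x)) ->
  {within `[a, b], continuous f}.
Proof.
move=> Hf; apply/within_itv_continuousP => x xab e e0.
have /has_deriv_inP/(_ 1 ltr01)[r r0 Hr] := Hf x xab.
pose K := `|df x| + 1; have K0 : 0 < K by rewrite /K ltr_wpDl.
exists (Num.min r (e / K)); first by rewrite lt_min r0 divr_gt0.
move=> y yab; rewrite lt_min => /andP[/(Hr y yab) H1 H2].
rewrite ltr_pdivlMr// in H2.
have -> : f y - f x = (f y - f x - df x * (y - x)) + df x * (y - x) by ring.
apply: (le_trans (ler_normD _ _)); rewrite normrM.
by apply: (le_trans (lerD H1 (lexx _))); rewrite -mulrDl addrC mulrC ltW.
Qed.

Lemma has_deriv_in_uniq (R : realType) (a b : R) (f g : R -> R) (x l m : R) :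
  a < b -> a <= x <= b -> (forall y, a <= y <= b -> f y = g y) ->
  has_deriv_in a b f x l -> has_deriv_in a b g x m -> l = m.
Proof.
move=> ab xab fg /has_deriv_inP Hf /has_deriv_inP Hg.
apply/eqP; rewrite -subr_eq0 -normr_le0; apply/ler_addgt0Pr => e e0.
rewrite add0r.
have e20 : 0 < e / 2 by rewrite divr_gt0.
have [r r0 Hr] := Hf _ e20; have [s s0 Hs] := Hg _ e20.
(* Since [a < b], one side of [x] has room of at least half the length of the interval; [y] is taken
   there, at a distance [t] below both radii. *)
have [y [yab yx yr ys]] : exists y, [/\ a <= y <= b, y != x, `|y - x| < r & `|y - x| < s].
  pose t := Num.min (Num.min r s) (b - a) / 2.
  have t0 : 0 < t by rewrite divr_gt0// !lt_min r0 s0 subr_gt0.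
  have t2 : t * 2 <= Num.min (Num.min r s) (b - a) by rewrite /t; lra.
  move: t2; rewrite !le_min => /andP[/andP[tr ts] tb].
  have [xm|xm] := leP x ((a + b) / 2).
    exists (x + t); rewrite addrAC subrr add0r gtr0_norm//.
    by split; [lra|rewrite gt_eqF//; lra|lra|lra].
  exists (x - t); rewrite addrAC subrr add0r normrN gtr0_norm//.
  by split; [lra|rewrite lt_eqF//; lra|lra|lra].
have := Hr y yab yr; have := Hs y yab ys; rewrite !fg// => H1 H2.
have yx0 : 0 < `|y - x| by rewrite normr_gt0 subr_eq0.
rewrite -(ler_pM2r yx0) -normrM.
have -> : (l - m) * (y - x) = (g y - g x - m * (y - x)) - (g y - g x - l * (y - x)) by ring.
apply: (le_trans (ler_normB _ _)); apply: (le_trans (lerD H1 H2)).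
by rewrite -mulrDl -splitr.
Qed.

Lemma has_deriv_in_lin (R : realType) (a b : R) (f g : R -> R) (c x l m : R) :
  has_deriv_in a b f x l -> has_deriv_in a b g x m ->
  has_deriv_in a b (fun y => f y + c * g y) x (l + c * m).
Proof.
move=> /has_deriv_inP Hf /has_deriv_inP Hg; apply/has_deriv_inP => e e0.
have e20 : 0 < e / 2 by rewrite divr_gt0.
have c0 : 0 < `|c| + 1 by rewrite ltr_wpDl.
have [r r0 Hr] := Hf _ e20.
have [s s0 Hs] := Hg _ (divr_gt0 e20 c0).
exists (Num.min r s); first by rewrite lt_min r0.
move=> y yab; rewrite lt_min => /andP[/(Hr _ yab) H1 /(Hs _ yab) H2].
have -> : f y + c * g y - (f x + c * g x) - (l + c * m) * (y - x) =
  (f y - f x - l * (y - x)) + c * (g y - g x - m * (y - x)) by ring.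
apply: (le_trans (ler_normD _ _)); rewrite [e]splitr mulrDl lerD// normrM.
apply: (@le_trans _ _ ((`|c| + 1) * `|g y - g x - m * (y - x)|)).
  by rewrite ler_wpM2r// lerDl.
by rewrite mulrC -ler_pdivlMr// mulrAC.
Qed.

Lemma has_deriv_in_cst (R : realType) (a b : R) (c x : R) :
  has_deriv_in a b (fun=> c) x 0.
Proof.
apply/has_deriv_inP => e e0; exists 1 => // y _ _.
by rewrite subrr mul0r subrr normr0 mulr_ge0// ltW.
Qed.

(** The mean value theorem asks for two-sided derivatives only strictly between the two points,
    where the restriction to [[a, b]] is void; one-sided derivatives at the ends are therefore
    enough. *)
Lemma has_deriv_in_lip (R : realType) (a b : R) (f df : R -> R) (M : R) :
  (forall x, a <= x <= b -> has_deriv_in a b f x (df x)) ->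
  (forall x, a <= x <= b -> `|df x| <= M) ->
  forall x y, a <= x <= b -> a <= y <= b -> `|f y - f x| <= M * `|y - x|.
Proof.
move=> Hf HM.
have key x y : a <= x <= b -> a <= y <= b -> x <= y -> `|f y - f x| <= M * `|y - x|.
  move=> xab yab xy.
  have cf := has_deriv_in_cont _ _ _ _ _ Hf.
  have [z| |c] := @MVT_segment _ f df x y xy.
  - rewrite in_itv/= => /andP[xz zy]; apply/is_derive1P => e e0.
    have zab : a <= z <= b by lra.
    have /has_deriv_inP/(_ _ e0)[r r0 Hr] := Hf z zab.
    exists (Num.min r (Num.min (z - x) (y - z))).
      by rewrite !lt_min r0 !subr_gt0 xz.
    move=> t; rewrite !lt_min => /andP[tr /andP[t1 t2]]; apply: Hr => //.
    by move: t1 t2; rewrite !ltr_norml => /andP[? ?] /andP[? ?]; apply/andP; split; lra.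
  - move/within_itv_continuousP : cf => cf; apply/within_itv_continuousP => z zxy e e0.
    have [|r r0 Hr] := cf z _ e e0; first by lra.
    by exists r => // t txy; apply: Hr; lra.
  - rewrite in_itv/= => cxy ->; rewrite normrM ler_wpM2r//; apply: HM; lra.
move=> x y xab yab; have [xy|/ltW yx] := leP x y; first exact: key.
by rewrite distrC (distrC y); exact: key.
Qed.

(* For a fixed increment [y - x], compare an [e]-approximant [f1] with an
   approximant [f2] so close to [f] that its error is at most [e |y - x|]; the
   mean value inequality controls the increment of [f1 - f2]. *)
Lemma isC1_closed (R : realType) (a b : R) (f df : R -> R) :
  (forall e, 0 < e -> exists f1 df1 : R -> R, isC1 a b f1 df1 /\
     forall x, a <= x <= b -> `|f1 x - f x| <= e /\ `|df1 x - df x| <= e) ->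
  isC1 a b f df.
Proof.
move=> H; split.
  move=> x xab; apply/has_deriv_inP => e e0.
  have e6 : 0 < e / 6 by lra.
  have [f1 [df1 [[C1 _] A1]]] := H _ e6.
  have /has_deriv_inP/(_ _ e6)[r r0 Hr] := C1 x xab.
  exists r => // y yab yx; have [->|nyx] := eqVneq y x.
    by rewrite !subrr mulr0 subrr normr0 mulr0.
  have yx0 : 0 < `|y - x| by rewrite normr_gt0 subr_eq0.
  pose e' := Num.min (e / 6) (e / 6 * `|y - x|).
  have e'0 : 0 < e' by rewrite lt_min e6 mulr_gt0.
  have [f2 [df2 [[C2 _] A2]]] := H _ e'0.
  have L : `|(f1 y + (-1) * f2 y) - (f1 x + (-1) * f2 x)| <= e / 3 * `|y - x|.
    apply: (@has_deriv_in_lip _ a b (fun z => f1 z + (-1) * f2 z)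
             (fun z => df1 z + (-1) * df2 z)) => //.
    - by move=> z zab; apply: has_deriv_in_lin; [exact: C1|exact: C2].
    - move=> z zab; have [_ B1] := A1 z zab; have [_ B2] := A2 z zab.
      have e'e : e' <= e / 6 by rewrite ge_min lexx.
      have -> : df1 z + (-1) * df2 z = (df1 z - df z) - (df2 z - df z) by ring.
      by apply: (le_trans (ler_normB _ _)); lra.
  have e'e : e' <= e / 6 * `|y - x| by rewrite ge_min lexx orbT.
  have [B1 _] := A2 x xab; have [B2 _] := A2 y yab; have [_ B3] := A1 x xab.
  have B4 := Hr y yab yx.
  have B5 : `|(df1 x - df x) * (y - x)| <= e / 6 * `|y - x| by rewrite normrM ler_pM2r.
  (* In units of [|y - x|], the four groups cost [e / 6], [e / 3], [e / 6] and [e / 3], which add up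
     to [e]. *)
  have -> : f y - f x - df x * (y - x) =
    (f1 y - f1 x - df1 x * (y - x)) - ((f1 y + (-1) * f2 y) - (f1 x + (-1) * f2 x))
     + (df1 x - df x) * (y - x) + ((f2 x - f x) - (f2 y - f y)) by ring.
  apply: (le_trans (ler_normD _ _)).
  have B6 := ler_normB (f2 x - f x) (f2 y - f y).
  have B7 := ler_normD (f1 y - f1 x - df1 x * (y - x) -
      (f1 y + -1 * f2 y - (f1 x + -1 * f2 x))) ((df1 x - df x) * (y - x)).
  have B8 := ler_normB (f1 y - f1 x - df1 x * (y - x))
      (f1 y + -1 * f2 y - (f1 x + -1 * f2 x)).
  lra.
apply/within_itv_continuousP => x xab e e0.
have e3 : 0 < e / 3 by lra.
have [f1 [df1 [[_ /within_itv_continuousP C1] A1]]] := H _ e3.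
have [r r0 Hr] := C1 x xab _ e3.
exists r => // y yab yx.
have [_ B1] := A1 x xab; have [_ B2] := A1 y yab; have B3 := Hr y yab yx.
have -> : df y - df x = (df1 y - df1 x) - (df1 y - df y) + (df1 x - df x) by ring.
apply: (le_trans (ler_normD _ _)).
have := ler_normB (df1 y - df1 x) (df1 y - df y); lra.
Qed.

Lemma isC1_cont (R : realType) (a b : R) (f df : R -> R) :
  isC1 a b f df -> {within `[a, b], continuous f}.
Proof. by move=> [Hf _]; exact: has_deriv_in_cont Hf. Qed.

Lemma within_itv_continuous_lin (R : realType) (a b c : R) (f g : R -> R) :
  {within `[a, b], continuous f} -> {within `[a, b], continuous g} ->
  {within `[a, b], continuous (fun x => f x + c * g x)}.
Proof.
move=> /within_itv_continuousP Hf /within_itv_continuousP Hg.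
apply/within_itv_continuousP => x xab e e0.
have e20 : 0 < e / 2 by rewrite divr_gt0.
have c0 : 0 < `|c| + 1 by rewrite ltr_wpDl.
have [r r0 Hr] := Hf x xab _ e20; have [s s0 Hs] := Hg x xab _ (divr_gt0 e20 c0).
exists (Num.min r s); first by rewrite lt_min r0.
move=> y yab; rewrite lt_min => /andP[/(Hr _ yab) H1 /(Hs _ yab) H2].
have -> : f y + c * g y - (f x + c * g x) = (f y - f x) + c * (g y - g x) by ring.
apply: (le_trans (ler_normD _ _)); rewrite [e]splitr lerD// normrM.
apply: (@le_trans _ _ ((`|c| + 1) * `|g y - g x|)).
  by rewrite ler_wpM2r// lerDl.
by rewrite mulrC -ler_pdivlMr.
Qed.

Lemma isC1_lin (R : realType) (a b c : R) (f df g dg : R -> R) :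
  isC1 a b f df -> isC1 a b g dg ->
  isC1 a b (fun x => f x + c * g x) (fun x => df x + c * dg x).
Proof.
move=> [f1 f2] [g1 g2]; split; last exact: within_itv_continuous_lin.
by move=> x xab; apply: has_deriv_in_lin; [exact: f1|exact: g1].
Qed.

Lemma isC1_cst (R : realType) (a b c : R) : isC1 a b (fun=> c) (fun=> 0).
Proof.
split; first by move=> x _; exact: has_deriv_in_cst.
apply/within_itv_continuousP => x _ e e0; exists 1 => // y _ _.
by rewrite subrr normr0 ltW.
Qed.

(** A pair that agrees with the target on [[a, b]] is an approximant of error 0, so this is a case
    of closedness. *)
Lemma isC1_ext (R : realType) (a b : R) (f df g dg : R -> R) :
  (forall x, a <= x <= b -> f x = g x) -> (forall x, a <= x <= b -> df x = dg x) ->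
  isC1 a b f df -> isC1 a b g dg.
Proof.
move=> fg dfg H; apply: isC1_closed => e e0; exists f, df; split => // x xab.
by rewrite fg// dfg// !subrr normr0 ltW.
Qed.

Lemma isC1_deriv_uniq (R : realType) (a b : R) (f df g dg : R -> R) :
  a < b -> (forall x, a <= x <= b -> f x = g x) ->
  isC1 a b f df -> isC1 a b g dg -> forall x, a <= x <= b -> df x = dg x.
Proof.
by move=> ab fg [Hf _] [Hg _] x xab; apply: has_deriv_in_uniq (Hf x xab) (Hg x xab).
Qed.

Lemma within_itv_continuous_bounded (R : realType) (a b : R) (f : R -> R) :
  a < b -> {within `[a, b], continuous f} ->
  exists2 M, 0 <= M & forall x, a <= x <= b -> `|f x| <= M.
Proof.
move=> ab /within_itv_continuousP cf.
have [|c _ Hc] := @EVT_max R (fun x => `|f x|) a b (ltW ab).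
  apply/within_itv_continuousP => x xab e /(cf x xab)[r r0 Hr].
  exists r => // y yab yx; apply: le_trans (Hr y yab yx).
  exact: ler_dist_dist.
by exists `|f c| => // x xab; apply: Hc; rewrite in_itv.
Qed.

Lemma isC1_bounded (R : realType) (a b : R) (f df : R -> R) : a < b ->
  isC1 a b f df ->
  exists2 M, 0 <= M & forall x, a <= x <= b -> `|f x| <= M /\ `|df x| <= M.
Proof.
move=> ab fC; have [M M0 HM] := within_itv_continuous_bounded _ _ _ _ ab (isC1_cont _ _ _ _ _ fC).
have [N N0 HN] := within_itv_continuous_bounded _ _ _ _ ab fC.2.
exists (Num.max M N); first by rewrite le_max M0.
by move=> x xab; rewrite !le_max HM// HN// orbT.
Qed.

(** * Sup norm and C1 norm *)

Lemma supnorm_ub (R : realType) (a b : R) (f : R -> R) (M x : R) :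
  (forall y, a <= y <= b -> `|f y| <= M) -> a <= x <= b -> `|f x| <= supnorm a b f.
Proof.
move=> HM xab; apply: ub_le_sup.
  by exists M => _ [y + <-]; rewrite /= in_itv/=; exact: HM.
by exists x => //; rewrite /= in_itv.
Qed.

Lemma supnorm_le (R : realType) (a b : R) (f : R -> R) (M : R) :
  a < b -> (forall y, a <= y <= b -> `|f y| <= M) -> supnorm a b f <= M.
Proof.
move=> ab HM; apply: ge_sup.
  by exists `|f a|, a => //; rewrite /= in_itv/= lexx ltW.
by move=> _ [y + <-]; rewrite /= in_itv/=; exact: HM.
Qed.

Lemma C1norm_ub (R : realType) (a b : R) (f df : R -> R) (x : R) :
  a < b -> isC1 a b f df -> a <= x <= b ->
  `|f x| + `|df x| <= C1norm a b f df.
Proof.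
move=> ab fC xab; have [M M0 HM] := isC1_bounded _ _ _ _ _ ab fC.
by rewrite lerD// (supnorm_ub _ _ _ _ M)// => y /HM[].
Qed.

Lemma C1norm_le (R : realType) (a b : R) (f df : R -> R) (M N : R) : a < b ->
  (forall x, a <= x <= b -> `|f x| <= M) -> (forall x, a <= x <= b -> `|df x| <= N) ->
  C1norm a b f df <= M + N.
Proof. by move=> ab HM HN; rewrite lerD// supnorm_le. Qed.

Lemma C1norm_ge0 (R : realType) (a b : R) (f df : R -> R) :
  a < b -> isC1 a b f df -> 0 <= C1norm a b f df.
Proof.
move=> ab fC; apply: le_trans (C1norm_ub _ _ _ _ _ a ab fC _); last first.
  by rewrite lexx ltW.
by rewrite addr_ge0.
Qed.

Lemma C1norm_lin (R : realType) (a b c : R) (f df g dg : R -> R) :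
  a < b -> isC1 a b f df -> isC1 a b g dg ->
  C1norm a b (fun x => f x + c * g x) (fun x => df x + c * dg x) <=
  C1norm a b f df + `|c| * C1norm a b g dg.
Proof.
move=> ab fC gC.
have [M M0 HM] := isC1_bounded _ _ _ _ _ ab fC.
have [N N0 HN] := isC1_bounded _ _ _ _ _ ab gC.
rewrite /C1norm mulrDr addrACA; apply: C1norm_le => // x xab.
  apply: (le_trans (ler_normD _ _)); rewrite normrM lerD ?ler_wpM2l//.
    by apply: (supnorm_ub _ _ _ _ M) => // y /HM[].
  by apply: (supnorm_ub _ _ _ _ N) => // y /HN[].
apply: (le_trans (ler_normD _ _)); rewrite normrM lerD ?ler_wpM2l//.
  by apply: (supnorm_ub _ _ _ _ M) => // y /HM[].
by apply: (supnorm_ub _ _ _ _ N) => // y /HN[].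
Qed.

(** The gap returns some derivative of an iterate, not a prescribed one. Uniqueness of derivatives
    makes the norm depend on the function alone, so that different witnesses can be compared. *)
Lemma C1norm_ext (R : realType) (a b : R) (f df g dg : R -> R) :
  a < b -> isC1 a b f df -> isC1 a b g dg ->
  (forall x, a <= x <= b -> f x = g x) -> C1norm a b f df = C1norm a b g dg.
Proof.
move=> ab fC gC fg; have dfg := isC1_deriv_uniq _ _ _ _ _ _ _ ab fg fC gC.
have sup_ext (u v : R -> R) : (forall x, a <= x <= b -> u x = v x) ->
    supnorm a b u = supnorm a b v.
  move=> uv; rewrite /supnorm; congr sup.
  by apply: eq_imagel => x; rewrite /= in_itv/= => xab; rewrite uv.
by rewrite /C1norm (sup_ext f g)// (sup_ext df dg).
Qed.

Lemma isC1_sub_div (R : realType) (a b c : R) (f df g dg : R -> R) :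
  isC1 a b f df -> isC1 a b g dg ->
  isC1 a b (fun x => (f x - g x) / c) (fun x => (df x - dg x) / c).
Proof.
move=> fC gC; have H := isC1_lin _ _ _ c^-1 _ _ _ _ (isC1_cst _ a b 0)
  (isC1_lin _ _ _ (-1) _ _ _ _ fC gC).
by apply: isC1_ext H => x xab; rewrite add0r mulN1r mulrC.
Qed.

Lemma isC1_sub (R : realType) (a b : R) (f df g dg : R -> R) :
  isC1 a b f df -> isC1 a b g dg ->
  isC1 a b (fun x => f x - g x) (fun x => df x - dg x).
Proof.
move=> fC gC; apply: isC1_ext (isC1_lin _ _ _ (-1) _ _ _ _ fC gC) => x xab;
  by rewrite mulN1r.
Qed.

Lemma isC1_sum (R : realType) (a b : R) (u du : nat -> R -> R) (n : nat) :
  (forall z, isC1 a b (u z) (du z)) ->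
  isC1 a b (fun x => \sum_(0 <= z < n) u z x) (fun x => \sum_(0 <= z < n) du z x).
Proof.
move=> uC; elim: n => [|n IH].
  by apply: isC1_ext (isC1_cst _ a b 0) => x _; rewrite big_geq.
apply: isC1_ext (isC1_lin _ _ _ 1 _ _ _ _ IH (uC n)) => x _;
  by rewrite big_nat_recr//= mul1r.
Qed.

(** * Series of reals with a summable majorant *)

Lemma majorant_cvgn (R : realType) (m u : nat -> R) :
  (forall z, `|u z| <= m z) -> cvgn (series m) -> cvgn (series u).
Proof.
move=> um cm; apply: (@normed_cvg R R^o).
apply: (@series_le_cvg _ (fun z => `|u z|) m _ _ um cm) => [z|z] //.
exact: le_trans (normr_ge0 _) (um z).
Qed.

(** [N] is chosen before [u]: one index serves all series under the same majorant, hence all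
    parameters and all points at once. *)
Lemma majorant_tail (R : realType) (m : nat -> R) (e : R) :
  cvgn (series m) -> 0 < e ->
  exists N, forall n, (N <= n)%N -> forall u : nat -> R, (forall z, `|u z| <= m z) ->
    `|limn (series u) - series u n| <= e.
Proof.
move=> cm e0.
have e20 : 0 < e / 2 by rewrite divr_gt0.
have [N _ HN] := (cvgrPdist_le _ _).1 cm _ e20.
exists N => n Nn u um; apply/ler_addgt0Pr => d d0.
have cu := majorant_cvgn _ _ _ um cm.
have [K _ HK] := (cvgrPdist_le _ _).1 cu _ d0.
(* Between [n] and [k] the sum is finite and bounded through [m]; beyond [k] only the arbitrary
   error [d] of the convergence of [u] itself is left. *)
pose k := maxn K n.
have /= Hk : `|limn (series u) - series u k| <= d by apply: HK; rewrite /= leq_maxl.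
have nk : (n <= k)%N by rewrite leq_maxr.
have H : `|series u k - series u n| <= series m k - series m n.
  rewrite !sub_series_geq//; apply: (le_trans (ler_norm_sum _ _ _)).
  exact: ler_sum.
have Hmk : `|limn (series m) - series m k| <= e / 2 by apply: HN; exact: leq_trans Nn nk.
have Hmn : `|limn (series m) - series m n| <= e / 2 by apply: HN.
have -> : limn (series u) - series u n = (limn (series u) - series u k)
   + (series u k - series u n) by ring.
apply: (le_trans (ler_normD _ _)).
move: Hmk Hmn; rewrite !ler_norml => /andP[? ?] /andP[? ?]; lra.
Qed.

(** * The normalised integral on continuous functions *)

Lemma within_itv_integrable (R : realType) (a b : R) (f : R -> R) :
  {within `[a, b], continuous f} ->
  (@lebesgue_measure R).-integrable `[a, b] (EFin \o f).
Proof. by move=> cf; apply: continuous_compact_integrable => //; exact: segment_compact. Qed.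

Lemma mint_lin (R : realType) (a b c : R) (f g : R -> R) :
  {within `[a, b], continuous f} -> {within `[a, b], continuous g} ->
  mint a b (fun x => f x + c * g x) = mint a b f + c * mint a b g.
Proof.
move=> /within_itv_integrable fi /within_itv_integrable gi.
rewrite /mint RintegralD//; last exact: (integrableZl _ c gi).
by rewrite RintegralZl// mulrDl mulrA.
Qed.

Lemma mint_ext (R : realType) (a b : R) (f g : R -> R) :
  (forall x, a <= x <= b -> f x = g x) -> mint a b f = mint a b g.
Proof.
move=> fg; rewrite /mint; congr (_ / _); apply: eq_Rintegral => x.
by rewrite inE /= in_itv/=; exact: fg.
Qed.

Lemma mint_cst (R : realType) (a b c : R) : a < b -> mint a b (fun=> c) = c.
Proof.
move=> ab; rewrite /mint Rintegral_cst//.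
rewrite [X in fine X](_ : _ = (b - a)%:E)/= ?mulfK ?subr_eq0 ?gt_eqF//.
by rewrite [LHS]lebesgue_measure_itv/= lte_fin ab EFinB.
Qed.

Lemma mint_le (R : realType) (a b K : R) (f : R -> R) : a < b ->
  {within `[a, b], continuous f} -> (forall x, a <= x <= b -> `|f x| <= K) ->
  `|mint a b f| <= K.
Proof.
move=> ab cf fK; rewrite -[leRHS](mint_cst _ a b)// /mint normrM normfV.
rewrite (gtr0_norm (_ : 0 < b - a)) ?subr_gt0// ler_pM2r ?invr_gt0 ?subr_gt0//.
have fi := within_itv_integrable _ _ _ _ cf.
apply: le_trans (le_normr_Rintegral _ fi) _ => //.
apply: le_Rintegral => //; first exact: integrable_norm fi.
exact: within_itv_integrable (isC1_cont _ _ _ _ _ (isC1_cst _ a b K)).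
Qed.

(** * Linear response for an abstract family of operators with a uniform gap *)

Section operator_perturbation.
Context (R : realType) (a b : R) (V : set R) (L : R -> (R -> R) -> R -> R).
Context (M theta C : R) (h dh : R -> R -> R).
Hypothesis ab : a < b.
Hypothesis V0 : V 0.
Hypothesis Llin : forall e f df g dg c, V e -> isC1 a b f df -> isC1 a b g dg ->
  forall x, a <= x <= b -> L e (fun y => f y + c * g y) x = L e f x + c * L e g x.
Hypothesis Lbd : forall e f df K, V e -> isC1 a b f df ->
  (forall x, a <= x <= b -> `|f x| <= K) ->
  forall x, a <= x <= b -> `|L e f x| <= M * K.
Hypothesis M0 : 0 <= M.
Hypothesis LC1 : forall f df, isC1 a b f df -> exists dL : R -> R -> R,
  (forall e, V e -> isC1 a b (L e f) (dL e)) /\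
  forall eta, 0 < eta -> exists2 r, 0 < r & forall e, `|e| < r -> V e /\
    forall x, a <= x <= b -> `|L e f x - L 0 f x| <= eta /\ `|dL e x - dL 0 x| <= eta.
Hypothesis theta01 : 0 < theta < 1.
Hypothesis C0 : 0 < C.
Hypothesis gap : forall e, V e -> forall f df, isC1 a b f df -> mint a b f = 0 ->
  forall n, (1 <= n)%N -> exists d, isC1 a b (iter n (L e) f) d /\
    C1norm a b (iter n (L e) f) d <= C * theta ^+ n * C1norm a b f df.
Hypothesis hC1 : forall e, V e -> isC1 a b (h e) (dh e).
Hypothesis hint : forall e, V e -> mint a b (h e) = 1.
Hypothesis hstat : forall e, V e -> forall x, a <= x <= b -> L e (h e) x = h e x.

Let theta_small e : 0 < e -> exists n, C * theta ^+ n <= e.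
Proof.
move=> e0; have : (fun n => theta ^+ n) @ \oo --> 0.
  by apply: cvg_expr; case/andP: theta01 => t0 t1; rewrite gtr0_norm.
move=> /cvgrPdist_le/(_ (e / C))[|N _ HN]; first by rewrite divr_gt0.
exists N; have := HN N (leqnn N); rewrite /= sub0r normrN.
rewrite ger0_norm; last by rewrite exprn_ge0//; case/andP: theta01 => /ltW.
by rewrite ler_pdivlMr// mulrC.
Qed.

(** [Lbd] with bound 0, applied to the difference [f - g]. *)
Let L_ext e f df g dg : V e -> isC1 a b f df -> isC1 a b g dg ->
  (forall x, a <= x <= b -> f x = g x) ->
  forall x, a <= x <= b -> L e f x = L e g x.
Proof.
move=> Ve fC gC fg x xab; apply/eqP; rewrite -subr_eq0 -normr_le0.
rewrite -mulN1r -(Llin _ _ _ _ _ (-1) Ve fC gC)// -(mulr0 M).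
apply: (Lbd _ _ _ _ Ve (isC1_lin _ _ _ _ _ _ _ _ fC gC)) => // y yab.
by rewrite fg// mulN1r subrr normr0.
Qed.

Let L_C1 e f df : V e -> isC1 a b f df -> exists d, isC1 a b (L e f) d.
Proof. by move=> Ve /LC1[dL [H _]]; exists (dL e); exact: H. Qed.

Let iter_C1 e f df n : V e -> isC1 a b f df -> exists d, isC1 a b (iter n (L e) f) d.
Proof.
move=> Ve fC; elim: n => [|n [d IH]]; first by exists df.
by rewrite iterS; exact: L_C1 IH.
Qed.

Let iter_ext e f df g dg n : V e -> isC1 a b f df -> isC1 a b g dg ->
  (forall x, a <= x <= b -> f x = g x) ->
  forall x, a <= x <= b -> iter n (L e) f x = iter n (L e) g x.
Proof.
move=> Ve fC gC fg; elim: n => [//|n IH] x xab; rewrite !iterS.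
have [d1 C1] := iter_C1 _ _ _ n Ve fC; have [d2 C2] := iter_C1 _ _ _ n Ve gC.
exact: L_ext C1 C2 IH _ _.
Qed.

Let iter_lin e f df g dg c n : V e -> isC1 a b f df -> isC1 a b g dg ->
  forall x, a <= x <= b ->
  iter n (L e) (fun y => f y + c * g y) x = iter n (L e) f x + c * iter n (L e) g x.
Proof.
move=> Ve fC gC; elim: n => [//|n IH] x xab; rewrite !iterS.
have [d1 C1] := iter_C1 _ _ _ n Ve fC; have [d2 C2] := iter_C1 _ _ _ n Ve gC.
have [d3 C3] := iter_C1 _ _ _ n Ve (isC1_lin _ _ _ c _ _ _ _ fC gC).
by rewrite (L_ext _ _ _ _ _ Ve C3 (isC1_lin _ _ _ c _ _ _ _ C1 C2) IH)// (Llin _ _ _ _ _ _ Ve C1 C2).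
Qed.

Let iter_stat e n : V e -> forall x, a <= x <= b -> iter n (L e) (h e) x = h e x.
Proof.
move=> Ve; elim: n => [//|n IH] x xab; rewrite iterS.
have [d C1] := iter_C1 _ _ _ n Ve (hC1 _ Ve).
by rewrite (L_ext _ _ _ _ _ Ve C1 (hC1 _ Ve) IH)// hstat.
Qed.

Let iter_bound e f df n : V e -> isC1 a b f df -> mint a b f = 0 -> (1 <= n)%N ->
  forall x, a <= x <= b -> `|iter n (L e) f x| <= C * theta ^+ n * C1norm a b f df.
Proof.
move=> Ve fC f0 n1 x xab; have [d [dC Hd]] := gap _ Ve _ _ fC f0 _ n1.
apply: le_trans Hd; apply: le_trans (C1norm_ub _ _ _ _ _ x ab dC xab).
by rewrite lerDl.
Qed.

(* Invariance of the integral is a consequence of the gap: if [mint f = 0] and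
   [c = mint (L f)], then both [L^(n+1) f] and [L^n (L f - c h)] tend to 0, so
   [c h = 0], although [mint h = 1]. *)
Let mint_L0 e f df : V e -> isC1 a b f df -> mint a b f = 0 -> mint a b (L e f) = 0.
Proof.
move=> Ve fC f0; have [d LfC] := L_C1 _ _ _ Ve fC.
have cf := isC1_cont _ _ _ _ _ LfC; have ch := isC1_cont _ _ _ _ _ (hC1 _ Ve).
set c := mint a b (L e f).
pose g x := L e f x + (- c) * h e x.
have gC : isC1 a b g (fun x => d x + (- c) * dh e x) := isC1_lin _ _ _ _ _ _ _ _ LfC (hC1 _ Ve).
have g0 : mint a b g = 0 by rewrite mint_lin// hint// mulr1 subrr.
have ch0 x : a <= x <= b -> c * h e x = 0.
  move=> xab; apply/eqP; rewrite -normr_le0; apply/ler_addgt0Pr => eta eta0; rewrite add0r.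
  set F := C1norm a b f df; set G := C1norm a b g (fun x => d x + - c * dh e x).
  have F0 : 0 <= F by exact: C1norm_ge0.
  have G0 : 0 <= G by exact: C1norm_ge0.
  have FG0 : 0 < F + G + 1 by lra.
  have [n Hn] := theta_small _ (divr_gt0 eta0 FG0).
  have t0 : 0 <= theta by case/andP: theta01 => /ltW.
  have t1 : theta <= 1 by case/andP: theta01 => _ /ltW.
  have B1 := iter_bound _ _ _ n.+1 Ve gC g0 isT _ xab.
  have B2 := iter_bound _ _ _ n.+2 Ve fC f0 isT _ xab.
  have E : iter n.+1 (L e) g x = iter n.+2 (L e) f x - c * h e x.
    rewrite (iter_lin _ _ _ _ _ (- c) n.+1 Ve LfC (hC1 _ Ve))// iter_stat// mulNr.
    by rewrite -iterSr.
  have -> : c * h e x = iter n.+2 (L e) f x - iter n.+1 (L e) g x by rewrite E; ring.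
  apply: (le_trans (ler_normB _ _)); apply: (le_trans (lerD B2 B1)).
  have tn0 : 0 <= theta ^+ n by rewrite exprn_ge0.
  have T1 : theta ^+ n.+1 <= theta ^+ n by rewrite exprS ler_piMl.
  have T2 : theta ^+ n.+2 <= theta ^+ n.
    by apply: le_trans T1; rewrite exprS ler_piMl// exprn_ge0.
  apply: (@le_trans _ _ (C * theta ^+ n * F + C * theta ^+ n * G)).
    by rewrite lerD// ler_wpM2r// ler_wpM2l// ltW.
  rewrite -mulrDr; apply: (@le_trans _ _ (eta / (F + G + 1) * (F + G))).
    by rewrite ler_wpM2r// addr_ge0.
  rewrite mulrAC ler_pdivrMr// ler_pM2l//; lra.
have := mint_lin _ a b c (fun=> 0) (h e) (isC1_cont _ _ _ _ _ (isC1_cst _ _ _ _)) ch.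
rewrite (mint_cst _ a b 0 ab) hint// mulr1 add0r => <-.
transitivity (mint a b (fun=> 0 : R)); last exact: mint_cst.
by apply: mint_ext => x xab; rewrite ch0// addr0.
Qed.

(** Subtracting [mint f] times the fixed point [h e] reduces to zero average. *)
Let mint_L e f df : V e -> isC1 a b f df -> mint a b (L e f) = mint a b f.
Proof.
move=> Ve fC; set c := mint a b f.
have gC := isC1_lin _ _ _ (- c) _ _ _ _ fC (hC1 _ Ve).
have [d LfC] := L_C1 _ _ _ Ve fC.
have := mint_L0 _ _ _ Ve gC.
rewrite mint_lin//; [|exact: isC1_cont fC|exact: isC1_cont (hC1 _ Ve)].
rewrite hint// mulr1 subrr => /(_ erefl).
rewrite (mint_ext _ _ _ _ (fun x => L e f x + (- c) * h e x)); last first.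
  by move=> x xab; rewrite (Llin _ _ _ _ _ _ Ve fC (hC1 _ Ve))// hstat.
rewrite mint_lin//; [|exact: isC1_cont LfC|exact: isC1_cont (hC1 _ Ve)].
by rewrite hint// mulr1 => /eqP; rewrite subr_eq0 => /eqP.
Qed.

(* Telescoping [u = sum_(k < n) L^k (u - L u) + L^n u]. *)
Let resolvent_bound : exists2 K, 0 <= K & forall e u du v dv, V e ->
  isC1 a b u du -> mint a b u = 0 -> isC1 a b v dv ->
  (forall x, a <= x <= b -> v x = u x - L e u x) ->
  C1norm a b u du <= K * C1norm a b v dv.
Proof.
(* With [C * theta ^+ N] at most 1/2, the remainder [L^(N+1) u] has at most half the norm of [u] and
   is absorbed on the left, whence the factor 2. The [N + 1] telescoping terms are bounded by 1 for
   the first and [C] for each later one. None of this depends on [e]. *)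
have [N HN] := theta_small (1/2) ltac:(lra).
have t0 : 0 <= theta by case/andP: theta01 => /ltW.
have t1 : theta <= 1 by case/andP: theta01 => _ /ltW.
exists (2 * (1 + N.+1%:R * C)).
  by rewrite mulr_ge0// addr_ge0// mulr_ge0// ltW.
move=> e u du v dv Ve uC u0 vC uv.
have [dLu LuC] := L_C1 _ _ _ Ve uC.
(* [L e] preserves the integral, so the gap also applies to [v]. *)
have v0 : mint a b v = 0.
  rewrite (mint_ext _ _ _ _ (fun x => u x + (- 1) * L e u x)).
    rewrite mint_lin; [|exact: isC1_cont uC|exact: isC1_cont LuC].
    by rewrite (mint_L _ _ _ Ve uC) u0 mulr0 addr0.
  by move=> x xab; rewrite uv// mulN1r.
have tele n : exists w dw, [/\ isC1 a b w dw,
    C1norm a b w dw <= (1 + n.+1%:R * C) * C1norm a b v dv &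
    forall x, a <= x <= b -> u x = w x + iter n.+1 (L e) u x].
  elim: n => [|n [w [dw [wC wn Hw]]]].
    exists v, dv; split => //.
      by rewrite ler_peMl ?C1norm_ge0// lerDl mulr_ge0// ltW.
    by move=> x xab; rewrite /= uv// subrK.
  have [d [dC Hd]] := gap _ Ve _ _ vC v0 n.+1 isT.
  exists (fun x => w x + 1 * iter n.+1 (L e) v x), (fun x => dw x + 1 * d x); split.
  - exact: isC1_lin.
  - apply: (le_trans (C1norm_lin _ _ _ _ _ _ _ _ ab wC dC)); rewrite normr1 mul1r.
    have Hd' : C * theta ^+ n.+1 * C1norm a b v dv <= C * C1norm a b v dv.
      rewrite ler_wpM2r ?C1norm_ge0// -[leRHS]mulr1 ler_wpM2l ?exprn_ile1// ltW//.
    apply: (le_trans (lerD wn (le_trans Hd Hd'))).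
    rewrite -mulrDl -[n.+2%:R]natr1.
    suff -> : 1 + n.+1%:R * C + C = 1 + (n.+1%:R + 1) * C by [].
    ring.
  - move=> x xab; rewrite Hw//.
    have E : iter n.+1 (L e) v x = iter n.+1 (L e) u x + (-1) * iter n.+2 (L e) u x.
      rewrite (iterSr n.+1) -(iter_lin _ _ _ _ _ (-1) n.+1 Ve uC LuC)//.
      apply: (iter_ext _ _ _ _ _ _ Ve vC (isC1_lin _ _ _ (-1) _ _ _ _ uC LuC)) => //.
      by move=> y yab; rewrite uv// mulN1r.
    by rewrite E; ring.
have [w [dw [wC wn Hw]]] := tele N.
have [d [dC Hd]] := gap _ Ve _ _ uC u0 N.+1 isT.
have U0 : 0 <= C1norm a b u du by exact: C1norm_ge0.
have W : C1norm a b w dw = C1norm a b (fun x => u x + (-1) * iter N.+1 (L e) u x)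
           (fun x => du x + (-1) * d x).
  apply: C1norm_ext => //; first exact: isC1_lin.
  by move=> x xab; rewrite (Hw x)//; ring.
have Hd2 : C1norm a b (iter N.+1 (L e) u) d <= 1 / 2 * C1norm a b u du.
  apply: (le_trans Hd); rewrite ler_wpM2r//; apply: le_trans HN.
  by rewrite ler_wpM2l ?(ltW C0)// exprS ler_piMl// exprn_ge0.
have Hu : C1norm a b u du <= C1norm a b w dw + C1norm a b (iter N.+1 (L e) u) d.
  rewrite (C1norm_ext _ _ _ _ _ (fun x => w x + 1 * iter N.+1 (L e) u x)
     (fun x => dw x + 1 * d x) ab uC)//.
  - by apply: (le_trans (C1norm_lin _ _ _ _ _ _ _ _ ab wC dC)); rewrite normr1 mul1r.
  - exact: isC1_lin.
  - by move=> x xab; rewrite Hw// mul1r.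
rewrite -mulrA; lra.
Qed.

Let L_sub_div e f df g dg c : V e -> isC1 a b f df -> isC1 a b g dg ->
  forall x, a <= x <= b -> L e (fun y => (f y - g y) / c) x = (L e f x - L e g x) / c.
Proof.
move=> Ve fC gC x xab.
have fgC := isC1_lin _ _ _ (-1) _ _ _ _ fC gC.
have kC := isC1_lin _ _ _ c^-1 _ _ _ _ (isC1_cst _ a b 0) fgC.
rewrite (L_ext _ _ _ _ _ Ve (isC1_sub_div _ _ _ c _ _ _ _ fC gC) kC)//; last first.
  by move=> y yab; rewrite add0r mulN1r mulrC.
rewrite (Llin _ _ _ _ _ _ Ve (isC1_cst _ a b 0) fgC)//.
rewrite (Llin _ _ _ _ _ _ Ve fC gC)// mulN1r mulrC.
have : `|L e (fun=> 0) x| <= M * 0.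
  by apply: (Lbd _ _ _ _ Ve (isC1_cst _ a b 0)) => // y _; rewrite normr0.
by rewrite mulr0 normr_le0 => /eqP ->; rewrite add0r.
Qed.

(** The solution is the Neumann series of the [L_0^n D], which converges geometrically in C1 because
    [D] has zero average. The equation passes to the limit by the sup bound [Lbd] alone. *)
Let poisson_solution D dD : isC1 a b D dD -> mint a b D = 0 ->
  exists hs dhs, [/\ isC1 a b hs dhs, mint a b hs = 0 &
    forall x, a <= x <= b -> hs x - L 0 hs x = D x].
Proof.
move=> DC D0; pose N := C1norm a b D dD.
have N0 : 0 <= N by exact: C1norm_ge0.
(* The gap speaks of [n >= 1] only; the extra 1 in [C + 1] covers the term [n = 0], whose norm is
   [N]. *)
pose m := geometric ((C + 1) * N) theta.
have t0 : 0 <= theta by case/andP: theta01 => /ltW.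
have cm : cvgn (series m).
  by apply: is_cvg_geometric_series; rewrite ger0_norm//; case/andP: theta01.
have /choice[dw Hdw] : forall n, exists d, isC1 a b (iter n (L 0) D) d /\
    C1norm a b (iter n (L 0) D) d <= m n.
  case=> [|n].
    exists dD; split=> //; rewrite /m /= expr0 mulr1 -/N mulrDl mul1r lerDr.
    by rewrite mulr_ge0// ltW.
  have [d [dC Hd]] := gap _ V0 _ _ DC D0 n.+1 isT.
  exists d; split=> //; apply: (le_trans Hd); rewrite /m /= -/N.
  by rewrite mulrAC ler_wpM2r ?exprn_ge0// ler_wpM2r// lerDl.
have wC n : isC1 a b (iter n (L 0) D) (dw n) by have [] := Hdw n.
have wm n x : a <= x <= b -> `|iter n (L 0) D x| <= m n /\ `|dw n x| <= m n.
  move=> xab; have [_ Hn] := Hdw n.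
  have := C1norm_ub _ _ _ _ _ _ ab (wC n) xab.
  have := normr_ge0 (iter n (L 0) D x); have := normr_ge0 (dw n x).
  by move=> *; split; lra.
pose W n x := \sum_(0 <= k < n) iter k (L 0) D x.
pose dW n x := \sum_(0 <= k < n) dw k x.
have WC n : isC1 a b (W n) (dW n) by exact: isC1_sum.
pose hs x := limn (series (fun n => iter n (L 0) D x)).
pose dhs x := limn (series (fun n => dw n x)).
have approx eta : 0 < eta -> exists K, forall n, (K <= n)%N -> forall x, a <= x <= b ->
    `|W n x - hs x| <= eta /\ `|dW n x - dhs x| <= eta.
  move=> /(majorant_tail _ _ _ cm)[K HK]; exists K => n Kn x xab.
  by split; rewrite distrC; apply: HK => // z; have [] := wm z x xab.
have hsC : isC1 a b hs dhs.
  apply: isC1_closed => e /approx[K HK]; exists (W K), (dW K); split=> //.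
  exact: HK.
have W0 n : mint a b (W n) = 0.
  elim: n => [|n IH].
    rewrite (mint_ext _ _ _ _ (fun=> 0)) ?mint_cst// => x _.
    by rewrite /W big_geq.
  rewrite (mint_ext _ _ _ _ (fun x => W n x + 1 * iter n (L 0) D x)); last first.
    by move=> x _; rewrite /W big_nat_recr//= mul1r.
  rewrite mint_lin ?IH; [|exact: isC1_cont (WC n)|exact: isC1_cont (wC n)].
  rewrite add0r mul1r; elim: n {IH} => [//|n IH].
  by rewrite iterS (mint_L _ _ _ V0 (wC n)).
exists hs, dhs; split=> //.
  apply/eqP; rewrite -normr_le0; apply/ler_addgt0Pr => eta /approx[K HK].
  rewrite add0r.
  have -> : mint a b hs = mint a b (fun x => hs x + (-1) * W K x).
    by rewrite mint_lin ?W0 ?mulr0 ?addr0//; [exact: isC1_cont hsC|exact: isC1_cont (WC K)].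
  apply: mint_le => //.
    exact: isC1_cont (isC1_lin _ _ _ (-1) _ _ _ _ hsC (WC K)).
  by move=> x xab; rewrite mulN1r distrC; have [] := HK K (leqnn K) x xab.
have LW n x : a <= x <= b -> L 0 (W n) x = W n.+1 x - D x.
  move=> xab; elim: n => [|n IH].
    (* The empty sum [W 0] is the zero function; written as [(D - D) / 1], it is evaluated by
       [L_sub_div]. *)
    rewrite (L_ext _ _ _ (fun y => (D y - D y) / 1) _ V0 (WC 0) (isC1_sub_div _ _ _ 1 _ _ _ _ DC DC))//.
      by rewrite (L_sub_div _ _ _ _ _ _ V0 DC DC)// /W big_nat1 /= !subrr mul0r.
    by move=> y yab; rewrite /W big_geq// subrr mul0r.
  rewrite (L_ext _ _ _ (fun y => W n y + 1 * iter n (L 0) D y) _ V0 (WC n.+1)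
    (isC1_lin _ _ _ 1 _ _ _ _ (WC n) (wC n)))//; last first.
    by move=> y yab; rewrite /W big_nat_recr//= mul1r.
  rewrite (Llin _ _ _ _ _ _ V0 (WC n) (wC n))// IH mul1r.
  by rewrite /W [in RHS]big_nat_recr//= addrAC.
move=> x xab; apply/eqP; rewrite -subr_eq0 -normr_le0; apply/ler_addgt0Pr => eta eta0.
rewrite add0r.
have M1 : 0 < M + 1 by rewrite ltr_wpDl.
(* [M] shares of [eta / (M + 1)] pay for the error of [W K] after applying [L 0], and one share for
   the error of [W K.+1]. *)
have [K HK] := approx _ (divr_gt0 eta0 M1).
have B1 : `|L 0 (fun y => W K y + (-1) * hs y) x| <= M * (eta / (M + 1)).
  apply: (Lbd _ _ _ _ V0 (isC1_lin _ _ _ (-1) _ _ _ _ (WC K) hsC)) => // y yab.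
  by rewrite mulN1r; have [] := HK K (leqnn K) y yab.
have [B2 _] := HK K.+1 (leqnSn K) x xab.
move: B1; rewrite (Llin _ _ _ _ _ _ V0 (WC K) hsC)// LW// mulN1r => B1.
have -> : hs x - L 0 hs x - D x = (W K.+1 x - D x - L 0 hs x) - (W K.+1 x - hs x) by ring.
apply: (le_trans (ler_normB _ _)); apply: (le_trans (lerD B1 B2)).
by rewrite -[X in _ + X]mul1r -mulrDl mulrCA divff ?gt_eqF// mulr1.
Qed.

(** [D] and [dD] enter only as uniform limits of difference quotients. The quotients are C1, and
    they have zero average since each [L e] preserves the integral; both properties pass to [D],
    which makes the Poisson equation solvable. *)
Lemma linear_response (D dD : R -> R) (dL0 : R -> R -> R) :
  (forall e, V e -> isC1 a b (L e (h 0)) (dL0 e)) ->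
  (forall eta, 0 < eta -> exists2 r, 0 < r & forall e, `|e| < r -> e != 0 ->
    forall x, a <= x <= b ->
      `|(L e (h 0) x - L 0 (h 0) x) / e - D x| <= eta /\
      `|(dL0 e x - dL0 0 x) / e - dD x| <= eta) ->
  exists hs dhs, [/\ isC1 a b hs dhs,
    (fun e => C1norm a b
        (fun x => (h e x - h 0 x) / e - hs x)
        (fun x => (dh e x - dh 0 x) / e - dhs x)) @ 0^' --> 0 &
    [/\ isC1 a b D dD, mint a b D = 0, mint a b hs = 0 &
      forall x, a <= x <= b -> hs x - L 0 hs x = D x]].
Proof.
move=> L0C quot.
have h0C := hC1 _ V0.
(* [V] is an arbitrary set in this section; the ball around 0 inside it is read off from [LC1]. *)
have Vball : exists2 r, 0 < r & forall e, `|e| < r -> V e.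
  have [dL [_ /(_ 1 ltr01)[r r0 Hr]]] := LC1 _ _ h0C.
  by exists r => // e /Hr[].
have qC e : V e -> isC1 a b (fun x => (L e (h 0) x - L 0 (h 0) x) / e)
    (fun x => (dL0 e x - dL0 0 x) / e).
  by move=> Ve; apply: isC1_sub_div; exact: L0C.
have approx eta : 0 < eta -> exists e, [/\ V e & forall x, a <= x <= b ->
      `|(L e (h 0) x - L 0 (h 0) x) / e - D x| <= eta /\
      `|(dL0 e x - dL0 0 x) / e - dD x| <= eta].
  move=> /quot[r r0 Hr]; have [s s0 Hs] := Vball.
  have t0 : 0 < Num.min r s / 2 by rewrite divr_gt0// lt_min r0.
  have t2 : Num.min r s / 2 < Num.min r s by lra.
  move: (t2); rewrite lt_min => /andP[tr ts].
  exists (Num.min r s / 2); split.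
    by apply: Hs; rewrite gtr0_norm.
  by apply: Hr; rewrite ?gtr0_norm// gt_eqF.
have DC : isC1 a b D dD.
  apply: isC1_closed => eta /approx[e [Ve He]].
  exists (fun x => (L e (h 0) x - L 0 (h 0) x) / e), (fun x => (dL0 e x - dL0 0 x) / e).
  by split; [exact: qC|exact: He].
have D0 : mint a b D = 0.
  apply/eqP; rewrite -normr_le0; apply/ler_addgt0Pr => eta /approx[e [Ve He]].
  rewrite add0r.
  set q := fun x => (L e (h 0) x - L 0 (h 0) x) / e.
  have q0 : mint a b q = 0.
    have HH : mint a b (fun x => 0 + e^-1 * (L e (h 0) x + (-1) * L 0 (h 0) x)) = 0.
      have LC := isC1_lin _ _ _ (-1) _ _ _ _ (L0C _ Ve) (L0C _ V0).
      rewrite (mint_lin _ a b e^-1 (fun=> 0)); [|exact: isC1_cont (isC1_cst _ _ _ _)|exact: isC1_cont LC].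
      rewrite mint_lin; [|exact: isC1_cont (L0C _ Ve)|exact: isC1_cont (L0C _ V0)].
      by rewrite (mint_L _ _ _ Ve h0C) (mint_L _ _ _ V0 h0C) mulN1r subrr mulr0 addr0 mint_cst.
    by rewrite -HH; apply: mint_ext => x _; rewrite /q add0r mulN1r mulrC.
  have -> : mint a b D = mint a b (fun x => D x + (-1) * q x).
    by rewrite mint_lin ?q0 ?mulr0 ?addr0//; [exact: isC1_cont DC|exact: isC1_cont (qC _ Ve)].
  apply: mint_le => //.
    exact: isC1_cont (isC1_lin _ _ _ (-1) _ _ _ _ DC (qC _ Ve)).
  by move=> x xab; rewrite mulN1r distrC; have [] := He x xab.
have [hs [dhs [hsC hs0 Hhs]]] := poisson_solution _ _ DC D0.
exists hs, dhs; split=> //.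
have [dLs [LsC Lsc]] := LC1 _ _ hsC.
have [K K0 HK] := resolvent_bound.
apply/cvgrPdist_le => eps eps0.
(* The 4 counts the errors of the quotient and of [L e hs - L 0 hs], each for the function and for
   its derivative. [K + 1] keeps the denominator positive when [K = 0]. *)
pose eta := eps / (4 * (K + 1)).
have K1 : 0 < 4 * (K + 1) by lra.
have eta0 : 0 < eta by rewrite divr_gt0.
have [r r0 Hr] := quot _ eta0; have [s s0 Hs] := Lsc _ eta0.
apply/nbhs_ballP; exists (Num.min r s); first by rewrite /= lt_min r0.
move=> e; rewrite /ball /= sub0r normrN lt_min => /andP[er es] e0.
have [Ve Hse] := Hs e es; have Hre := Hr e er e0.
rewrite sub0r normrN.
have heC := hC1 _ Ve.
have duC := isC1_sub_div _ _ _ e _ _ _ _ heC h0C.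
have uC := isC1_sub _ _ _ _ _ _ _ duC hsC.
have vC := isC1_lin _ _ _ 1 _ _ _ _ (isC1_sub _ _ _ _ _ _ _ (qC _ Ve) DC)
  (isC1_sub _ _ _ _ _ _ _ (LsC _ Ve) (LsC _ V0)).
rewrite ger0_norm; last exact: C1norm_ge0.
have u0 : mint a b (fun x => (h e x - h 0 x) / e - hs x) = 0.
  rewrite (mint_ext _ _ _ _ (fun x => ((-1) * hs x + e^-1 * (h e x + (-1) * h 0 x)))); last first.
    by move=> x _; rewrite !mulN1r addrC mulrC.
  have hC := isC1_lin _ _ _ (-1) _ _ _ _ heC h0C.
  have nhsC := isC1_lin _ _ _ (-1) _ _ _ _ (isC1_cst _ a b 0) hsC.
  rewrite mint_lin; last 2 first.
  - by apply: isC1_cont (isC1_ext _ _ _ _ _ _ _ _ _ nhsC) => x // _; rewrite add0r.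
  - exact: isC1_cont hC.
  rewrite (mint_ext _ _ _ _ (fun x => 0 + (-1) * hs x)); last by move=> x _; rewrite add0r.
  rewrite mint_lin; [|exact: isC1_cont (isC1_cst _ _ _ _)|exact: isC1_cont hsC].
  rewrite mint_lin; [|exact: isC1_cont heC|exact: isC1_cont h0C].
  by rewrite hs0 mint_cst// !hint// mulr0 mulr1 subrr mulr0 !addr0.
apply: (le_trans (HK _ _ _ _ _ Ve uC u0 vC _)).
  move=> x xab.
  have nhsC := isC1_sub _ _ _ _ _ _ _ duC hsC.
  have LsubE : L e (fun y => (h e y - h 0 y) / e - hs y) x =
      (L e (h e) x - L e (h 0) x) / e - L e hs x.
    rewrite (L_ext _ _ _ _ _ Ve nhsC (isC1_lin _ _ _ (-1) _ _ _ _ duC hsC))//; last first.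
      by move=> y _; rewrite mulN1r.
    rewrite (Llin _ _ _ _ _ _ Ve duC hsC)// (L_sub_div _ _ _ _ _ _ Ve heC h0C)//.
    by rewrite mulN1r.
  rewrite LsubE (hstat _ Ve)// (hstat _ V0)//.
  have <- := Hhs x xab.
  by ring.
have N4 : C1norm a b
  (fun x => (L e (h 0) x - L 0 (h 0) x) / e - D x + 1 * (L e hs x - L 0 hs x))
  (fun x => (dL0 e x - dL0 0 x) / e - dD x + 1 * (dLs e x - dLs 0 x)) <=
  (eta + eta) + (eta + eta).
  apply: C1norm_le => // x xab; have [A1 A2] := Hre x xab; have [B1 B2] := Hse x xab;
    rewrite mul1r; apply: (le_trans (ler_normD _ _)); lra.
apply: (le_trans (ler_wpM2l K0 N4)).
have -> : eps = (K + 1) * (4 * eta) by rewrite /eta; field; lra.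
have : 0 <= eta by rewrite ltW.
nra.
Qed.

End operator_perturbation.

(** * From joint continuity to uniformity in the parameter *)

Section slices.
Context (R : realType) (a b : R) (V : set R) (F : R -> R -> R).
Hypothesis FC : {within V `*` `[a, b]%classic, continuous (fun p => F p.1 p.2)}.

Let dist_slice t x e : V t -> a <= x <= b -> 0 < e -> exists2 r, 0 < r &
  forall s y, V s -> a <= y <= b -> `|s - t| < r -> `|y - x| < r ->
    `|F s y - F t x| <= e.
Proof.
move=> Vt xab e0.
have Atx : (V `*` `[a, b]%classic) (t, x) by split => //=; rewrite in_itv.
have := (subspace_continuousP _ _).1 FC (t, x) Atx.
move=> /cvgrPdist_le/(_ _ e0); rewrite near_withinE => /nbhs_ballP[r /= r0 Hr].
exists r => // s y Vs yab st yx; rewrite distrC.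
apply: (Hr (s, y)); first by split; rewrite /ball/= distrC.
by split => //=; rewrite in_itv.
Qed.

Lemma slice_continuous t : V t -> {within `[a, b], continuous (F t)}.
Proof.
move=> Vt; apply/within_itv_continuousP => x xab e e0.
have [r r0 Hr] := dist_slice _ _ _ Vt xab e0.
by exists r => // y yab yx; apply: Hr => //; rewrite subrr normr0.
Qed.

(** Compactness of [[a, b]] is used in [x] alone: near each [x], both [F t y] and [F 0 y] lie within
    [e / 2] of [F 0 x], and a finite cover yields one radius for [t]. *)
Lemma slice_uniform : open V -> V 0 -> forall e, 0 < e -> exists2 r, 0 < r &
  forall t, `|t| < r -> V t /\ forall x, a <= x <= b -> `|F t x - F 0 x| <= e.
Proof.
move=> oV V0 e e0; have e20 : 0 < e / 2 by rewrite divr_gt0.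
have [s /= s0 Hs] := (nbhs_ballP _ _).1 (open_nbhs_nbhs (conj oV V0)).
have VS t : `|t| < s -> V t.
  by move=> ts; apply: Hs; rewrite /ball /= sub0r normrN.
have /compact_near_coveringP/near_covering_withinP := @segment_compact R a b.
move=> /(_ _ (nbhs (0 : R)) (fun t x => V t -> `|F t x - F 0 x| <= e) _).
case=> [x|r /= r0 Hr].
  rewrite /= in_itv /= => xab.
  have [r r0 Hr] := dist_slice _ _ _ V0 xab e20.
  exists (ball x r, ball (0 : R) r) => /=.
    by split; apply: nbhsx_ballx.
  move=> [y t] /= [yx t0]; rewrite in_itv /= => yab Vt.
  move: yx t0; rewrite /ball /= sub0r normrN distrC => yx t0.
  have := Hr t y Vt yab; rewrite subr0 => /(_ t0 yx) H1.
  have := Hr 0 y V0 yab; rewrite subrr normr0 => /(_ r0 yx) H2.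
  have -> : F t y - F 0 y = (F t y - F 0 x) - (F 0 y - F 0 x) by ring.
  by apply: (le_trans (ler_normB _ _)); rewrite [e]splitr lerD.
exists (Num.min r s); first by rewrite lt_min r0.
move=> t; rewrite lt_min => /andP[tr ts]; split; first exact: VS.
move=> x xab; apply: (Hr t) => /=; last exact: VS.
  by rewrite sub0r normrN.
by rewrite in_itv.
Qed.

End slices.

(** * Summable suprema, the M-test and difference quotients *)

(** One infinite supremum would make the whole sum infinite, so each is a real number and can serve
    as a majorant. Nonemptiness of both sets keeps the suprema nonnegative rather than minus
    infinity. *)
Lemma ereal_sup_majorant (R : realType) (V A : set R) (f : nat -> R -> R -> R) :
  V !=set0 -> A !=set0 ->
  (\sum_(0 <= z <oo) ereal_sup [set (`|f z e x|)%:E | e in V & x in A] < +oo)%E ->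
  exists m : nat -> R, [/\ forall z, 0 <= m z, cvgn (series m) &
    forall z e x, V e -> A x -> `|f z e x| <= m z].
Proof.
move=> [v Vv] [x0 Ax0] Soo.
pose S z := ereal_sup [set (`|f z e x|)%:E | e in V & x in A].
have ubS z e x : V e -> A x -> (`|f z e x|%:E <= S z)%E.
  by move=> Ve Ax; apply: ereal_sup_ubound; exists e => //; exists x.
have S0 z : (0 <= S z)%E by apply: le_trans (ubS z _ _ Vv Ax0); rewrite lee_fin.
have Sfin z : S z \is a fin_num.
  rewrite ge0_fin_numE// ltey; apply/eqP => Sz; move: Soo.
  by rewrite (@nneseries_pinfty _ S xpredT z).
exists (fun z => fine (S z)); split.
- by move=> z; exact: fine_ge0.
- apply: nnseries_is_cvg => [z|]; first exact: fine_ge0.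
  by under eq_eseriesr do rewrite fineK//.
- by move=> z e x Ve Ax; rewrite -lee_fin fineK//; exact: ubS.
Qed.

(** Tails are controlled by [m], the finite remainder term by term. The set [A] and the separate
    limit [u0] allow two uses: continuity in the parameter, with [A] equal to [V], and difference
    quotients, which are meaningful only off 0 and whose limit is a derivative. *)
Lemma series_uniform (R : realType) (a b r0 : R) (A : set R)
  (u : nat -> R -> R -> R) (u0 : nat -> R -> R) (m : nat -> R) :
  0 < r0 -> cvgn (series m) ->
  (forall z t x, `|t| < r0 -> A t -> a <= x <= b -> `|u z t x| <= m z) ->
  (forall z x, a <= x <= b -> `|u0 z x| <= m z) ->
  (forall z eta, 0 < eta -> exists2 r, 0 < r & forall t, `|t| < r -> A t ->
     forall x, a <= x <= b -> `|u z t x - u0 z x| <= eta) ->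
  forall eta, 0 < eta -> exists2 r, 0 < r & forall t, `|t| < r -> A t ->
    forall x, a <= x <= b ->
    `|limn (series (fun z => u z t x)) - limn (series (fun z => u0 z x))| <= eta.
Proof.
move=> r00 cm um u0m uu0 eta eta0.
have eta3 : 0 < eta / 3 by rewrite divr_gt0.
have [N /(_ N (leqnn N)) HN] := majorant_tail _ _ _ cm eta3.
have fin n d : 0 < d -> exists2 r, 0 < r & forall t, `|t| < r -> A t ->
    forall x, a <= x <= b -> `|\sum_(0 <= z < n) u z t x - \sum_(0 <= z < n) u0 z x| <= d.
  elim: n d => [|n IH] d d0.
    by exists 1 => // t _ _ x _; rewrite !big_geq// subrr normr0 ltW.
  have d20 : 0 < d / 2 by rewrite divr_gt0.
  have [r r_0 Hr] := IH _ d20; have [s s0 Hs] := uu0 n _ d20.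
  exists (Num.min r s); first by rewrite lt_min r_0.
  move=> t; rewrite lt_min => /andP[tr ts] At x xab; rewrite !big_nat_recr//=.
  have := Hr t tr At x xab; have := Hs t ts At x xab; set p := \sum_(_ <= _ < _) _.
  set q := \sum_(_ <= _ < _) _ => H1 H2.
  have -> : p + u n t x - (q + u0 n x) = (p - q) + (u n t x - u0 n x) by ring.
  by apply: (le_trans (ler_normD _ _)); rewrite [d]splitr lerD.
have [r r_0 Hr] := fin N _ eta3.
exists (Num.min r r0); first by rewrite lt_min r_0.
move=> t; rewrite lt_min => /andP[tr tr0] At x xab.
have H1 := HN (fun z => u z t x) (fun z => um z t x tr0 At xab).
have H2 := HN (fun z => u0 z x) (fun z => u0m z x xab).
have := Hr t tr At x xab; move: H1 H2; rewrite /series /=.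
set p := \sum_(_ <= _ < _) _; set q := \sum_(_ <= _ < _) _.
set l := limn _; set k := limn _ => H1 H2 H3.
have -> : l - k = (l - p) - (k - q) + (p - q) by ring.
apply: (le_trans (ler_normD _ _)); have := ler_normB (l - p) (k - q); lra.
Qed.

Lemma isC1_series (R : realType) (a b : R) (u du : nat -> R -> R) (m dm : nat -> R) :
  (forall z, isC1 a b (u z) (du z)) -> cvgn (series m) -> cvgn (series dm) ->
  (forall z x, a <= x <= b -> `|u z x| <= m z) ->
  (forall z x, a <= x <= b -> `|du z x| <= dm z) ->
  isC1 a b (fun x => limn (series (fun z => u z x))) (fun x => limn (series (fun z => du z x))).
Proof.
move=> uC cm cdm um dum; apply: isC1_closed => e e0.
have [N HN] := majorant_tail _ _ _ cm e0; have [K HK] := majorant_tail _ _ _ cdm e0.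
pose n := maxn N K.
exists (fun x => \sum_(0 <= z < n) u z x), (fun x => \sum_(0 <= z < n) du z x).
split; first exact: isC1_sum.
move=> x xab; rewrite !(distrC (\sum_(_ <= _ < _) _)); split.
  by apply: HN => [|z]; [exact: leq_maxl|exact: um].
by apply: HK => [|z]; [exact: leq_maxr|exact: dum].
Qed.

Lemma mvt_quotient0 (R : realType) (f df : R -> R) (r t : R) :
  (forall s : R, `|s| < r -> is_derive s (1 : R) f (df s)) -> `|t| < r -> t != 0 ->
  exists2 s, `|s| <= `|t| & (f t - f 0) / t = df s.
Proof.
move=> Hf tr t0.
have key x y : `|x| < r -> `|y| < r -> x < y ->
    exists2 s, x < s < y & f y - f x = df s * (y - x).
  move=> xr yr xy.
  have D z : x <= z <= y -> is_derive z 1 f (df z).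
    move=> zxy; apply: Hf.
    by move: xr yr; rewrite !ltr_norml => /andP[? ?] /andP[? ?]; apply/andP; split; lra.
  have [z| |s] := @MVT R f df x y xy.
  - by rewrite in_itv/= => zxy; apply: D; lra.
  - apply: derivable_within_continuous => z; rewrite in_itv/= => /D Hz.
    by case: Hz.
  - by rewrite in_itv/= => sxy ->; exists s.
have r0 : `|0 : R| < r by rewrite normr0; exact: le_lt_trans (normr_ge0 _) tr.
have [tneg|tpos|t00] := ltgtP t 0; last by rewrite t00 eqxx in t0.
  have [s st E] := key _ _ tr r0 tneg; exists s.
    by rewrite !ltr0_norm//; lra.
  have -> : f t - f 0 = df s * t by rewrite -opprB E; ring.
  by rewrite mulfK.
have [s st E] := key _ _ r0 tr tpos; exists s.
  by rewrite !gtr0_norm//; lra.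
by rewrite E subr0 mulfK.
Qed.

(** Each quotient is a value of [fE] at an intermediate parameter no farther from 0 than [t]. That
    parameter varies with [x], which is harmless because the control on [fE] is uniform in [x]. *)
Lemma quotient_uniform (R : realType) (a b r0 m : R) (f fE : R -> R -> R) :
  0 < r0 ->
  (forall t x : R, `|t| < r0 -> a <= x <= b -> is_derive t (1 : R) (f ^~ x) (fE t x)) ->
  (forall t x, `|t| < r0 -> a <= x <= b -> `|fE t x| <= m) ->
  (forall eta, 0 < eta -> exists2 r, 0 < r & forall t, `|t| < r ->
     forall x, a <= x <= b -> `|fE t x - fE 0 x| <= eta) ->
  (forall t x, `|t| < r0 -> t != 0 -> a <= x <= b -> `|(f t x - f 0 x) / t| <= m) /\
  forall eta, 0 < eta -> exists2 r, 0 < r & forall t, `|t| < r -> t != 0 ->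
     forall x, a <= x <= b -> `|(f t x - f 0 x) / t - fE 0 x| <= eta.
Proof.
move=> r00 fD fEm fEu; split.
  move=> t x tr t0 xab.
  have [s st ->] := mvt_quotient0 _ _ _ _ _ (fun s sr => fD s x sr xab) tr t0.
  by apply: fEm => //; exact: le_lt_trans tr.
move=> eta /fEu[r r_0 Hr]; exists (Num.min r r0); first by rewrite lt_min r_0.
move=> t; rewrite lt_min => /andP[tr tr0] t0 x xab.
have [s st ->] := mvt_quotient0 _ _ _ _ _ (fun s sr => fD s x sr xab) tr0 t0.
by apply: Hr => //; exact: le_lt_trans tr.
Qed.

(** * Interchange of a series with an integral *)

(** The Cauchy criterion, with tolerances [1 / (k + 1)], expresses convergence by countably many
    comparisons with [f N]. *)
Lemma measurable_cvgn (d : measure_display) (T : measurableType d) (R : realType)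
  (f : nat -> T -> R) : (forall n, measurable_fun setT (f n)) ->
  measurable [set w | cvgn (f ^~ w)].
Proof.
move=> mf.
pose B k n p := [set w | `|f n w - f p w| <= k.+1%:R^-1].
rewrite (_ : [set w | _] = \bigcap_k \bigcup_N \bigcap_n B k (N + n)%N N).
  apply: bigcap_measurable => // k _; apply: bigcup_measurable => N _.
  apply: bigcap_measurable => // n _; rewrite -[B _ _ _]setTI.
  rewrite [X in measurable (_ `&` X)](_ : _ =
      (fun w => `|f (N + n)%N w - f N w|) @^-1` `]-oo, k.+1%:R^-1]).
    have mfN : measurable_fun setT (fun w => `|f (N + n)%N w - f N w|).
      by apply: measurableT_comp => //; exact: measurable_funB.
    by apply: mfN => //; exact: measurable_itv.
  by apply/seteqP; split=> w; rewrite /B /= in_itv.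
apply/seteqP; split=> w /=.
  move=> /cvg_ex[/= l /cvgrPdist_le fl] k _.
  have [N _ HN] := fl (k.+1%:R^-1 / 2) ltac:(by rewrite divr_gt0// invr_gt0).
  exists N => // n _; rewrite /B /=.
  have H1 := HN (N + n)%N (leq_addr _ _); have H2 := HN N (leqnn N).
  have -> : f (N + n)%N w - f N w = (l - f N w) - (l - f (N + n)%N w) by ring.
  by apply: (le_trans (ler_normB _ _)); rewrite [leRHS]splitr lerD.
move=> H; apply/cauchy_cvgP/cauchy_exP => e e0.
have [k Hk] : exists k, k.+1%:R^-1 < e.
  have [k _ Hk] := (cvgrPdist_lt _ _).1 (@cvg_harmonic R) e e0.
  by exists k; have := Hk k (leqnn k); rewrite /= sub0r normrN ger0_norm.
have [N _ HN] := H k I; exists (f N w), N => // n /= Nn.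
have := HN (n - N)%N I; rewrite /B /= subnKC// => Hn.
by rewrite /ball /= distrC; exact: le_lt_trans Hk.
Qed.

(* Off the convergence set the limit has the constant junk value [point]. *)
Lemma measurable_fun_limn (d : measure_display) (T : measurableType d) (R : realType)
  (f : nat -> T -> R) : (forall n, measurable_fun setT (f n)) ->
  measurable_fun setT (fun w => limn (f ^~ w)).
Proof.
move=> mf; have mC := measurable_cvgn _ _ _ _ mf.
rewrite -(setvU [set w | cvgn (f ^~ w)]); apply/measurable_funU => //.
  exact: measurableC.
split.
  apply: (eq_measurable_fun (cst point)) => // w; rewrite inE /= => nc.
  by rewrite (dvgP nc).
apply: (@measurable_fun_cvg _ _ _ _ f) => // n.
exact: measurable_funTS.
Qed.

(** Dominated convergence under the sum [G] of the [g z], taken in the extended reals. By monotone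
    convergence [G] is integrable, hence finite almost everywhere, and there the series of the [f z]
    converges. Elsewhere the limit is a default value, so its measurability needs the preceding
    lemma. *)
Lemma Rintegral_limn_series (d : measure_display) (T : measurableType d) (R : realType)
  (mu : {measure set T -> \bar R}) (f g : nat -> T -> R) :
  (forall z, mu.-integrable setT (EFin \o f z)) ->
  (forall z, mu.-integrable setT (EFin \o g z)) ->
  (forall z w, `|f z w| <= g z w) ->
  cvgn (series (fun z => \int[mu]_w g z w)) ->
  \int[mu]_w limn (fun n => \sum_(0 <= z < n) f z w) =
  limn (series (fun z => \int[mu]_w f z w)).
Proof.
move=> fi gi fg cg.
have g0 z w : 0 <= g z w by exact: le_trans (fg z w).
have mf z : measurable_fun setT (f z) by exact/measurable_EFinP/(measurable_int mu).
have mg z : measurable_fun setT (EFin \o g z) by exact: (measurable_int mu).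
pose G w := (\sum_(0 <= z <oo) (g z w)%:E)%E.
have G0 w : (0 <= G w)%E by apply: nneseries_ge0 => z _ _; rewrite lee_fin.
have mG : measurable_fun setT G.
  apply: (@ge0_emeasurable_sum _ _ _ _ (fun z w => (g z w)%:E) xpredT) => //.
  - by move=> z w _ _; rewrite lee_fin.
  - by move=> z _; exact: mg.
have Eg z : (\int[mu]_w (g z w)%:E)%E = (\int[mu]_w g z w)%:E.
  by rewrite /Rintegral fineK//; apply: integrable_fin_num => //; exact: gi.
have IG : (\int[mu]_w G w < +oo)%E.
  rewrite integral_nneseries//; last by move=> z w _; rewrite lee_fin.
  under eq_eseriesr do rewrite Eg.
  rewrite (_ : (\sum_(0 <= z <oo) _)%E = (limn (series (fun z => \int[mu]_w g z w)))%:E).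
    by rewrite ltry.
  by rewrite -EFin_lim//; apply: congr_lim; apply/funext => n /=; rewrite sumEFin.
have Gi : mu.-integrable setT G.
  apply/integrableP; split=> //; rewrite (eq_integral G)// => w _.
  by rewrite gee0_abs.
pose S n w := \sum_(0 <= z < n) f z w.
have Si n : mu.-integrable setT (EFin \o S n) /\
    \int[mu]_w S n w = series (fun z => \int[mu]_w f z w) n.
  elim: n => [|n [IH1 IH2]].
    have -> : S 0 = cst 0 by apply/funext => w; rewrite /S big_geq.
    split; first exact: integrable0.
    by rewrite /Rintegral integral0 /series /= big_geq.
  have E : S n.+1 = (fun w => S n w + f n w).
    by apply/funext => w; rewrite /S big_nat_recr.
  rewrite E; split; first exact: integrableD IH1 (fi n).
  by rewrite RintegralD// IH2 /series /= big_nat_recr.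
have mS n : measurable_fun setT (S n).
  by have [/(measurable_int mu)/measurable_EFinP] := Si n.
have [| | | | |Li _ cvgL] := @dominated_convergence _ _ _ mu setT measurableT
    (fun n w => (S n w)%:E) (fun w => (limn (S ^~ w))%:E) G.
- by move=> n; exact/measurable_EFinP.
- exact/measurable_EFinP/measurable_fun_limn.
- apply: filterS (integrable_ae measurableT Gi) => w /(_ I) Gw _.
  have cgw : cvgn (series (g ^~ w)).
    apply: nnseries_is_cvg => [z|]; first exact: g0.
    by move: Gw; rewrite ge0_fin_numE.
  have cS : cvgn (S ^~ w) by exact: majorant_cvgn (fg ^~ w) cgw.
  by apply: cvg_EFin => //; exact: nearW.
- exact: Gi.
- apply: aeW => w n _; rewrite /S abse_EFin.
  have gn0 z : (0 <= z)%N -> true -> (0 <= (g z w)%:E)%E by rewrite lee_fin.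
  apply: (le_trans _ (nneseries_lim_ge n gn0)).
  rewrite sumEFin lee_fin; apply: (le_trans (ler_norm_sum _ _ _)).
  by apply: ler_sum.
apply/esym/cvg_lim => //.
have -> : series (fun z => \int[mu]_w f z w) = (fun n => \int[mu]_w S n w).
  by apply/funext => n; have [_ ->] := Si n.
apply: fine_cvg; rewrite fineK//; exact: integrable_fin_num.
Qed.

Lemma limn_series_norm_le (R : realType) (m u : nat -> R) :
  (forall z, `|u z| <= m z) -> cvgn (series m) -> `|limn (series u)| <= limn (series m).
Proof.
move=> um cm; have cn : cvgn [normed series u].
  by apply: (@series_le_cvg _ (fun z => `|u z|) m _ _ um cm) => [z|z] //;
    exact: le_trans (normr_ge0 _) (um z).
apply: (le_trans (@lim_series_norm _ R^o _ cn)).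
exact: lim_series_le.
Qed.

Lemma limn_series_lin (R : realType) (u v : nat -> R) (c : R) :
  cvgn (series u) -> cvgn (series v) ->
  limn (series (fun z => u z + c * v z)) = limn (series u) + c * limn (series v).
Proof.
move=> cu cv; have ckv : cvgn (series (c *: v)) by exact: is_cvg_seriesZ.
by rewrite -[_ * _](lim_seriesZ c cv) -lim_seriesD.
Qed.

Lemma limn_series_sub_div (R : realType) (u v : nat -> R) (c : R) :
  cvgn (series u) -> cvgn (series v) ->
  limn (series (fun z => (u z - v z) / c)) = (limn (series u) - limn (series v)) / c.
Proof.
move=> cu cv; have cuv : cvgn (series (u - v)) by exact: is_cvg_seriesB.
rewrite -lim_seriesB// mulrC -[_ * _](lim_seriesZ c^-1 cuv).
by congr (limn (series _)); apply/funext => z; rewrite mulrC.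
Qed.

(** A disagreement at one point would persist on an interval of positive length contained in a null
    set. This turns the almost-everywhere stationarity equation into a pointwise one. *)
Lemma within_itv_continuous_ae_eq (R : realType) (a b : R) (f g : R -> R) : a < b ->
  {within `[a, b], continuous f} -> {within `[a, b], continuous g} ->
  {ae @lebesgue_measure R, forall x, x \in `[a, b] -> f x = g x} ->
  forall x, a <= x <= b -> f x = g x.
Proof.
move=> ab fC gC [N [mN N0 subN]] x xab.
apply/eqP; rewrite -subr_eq0 -normr_le0 leNgt; apply/negP => fgx.
have /within_itv_continuousP := within_itv_continuous_lin _ _ _ (-1) _ _ fC gC.
have d20 : 0 < `|f x - g x| / 2 by rewrite divr_gt0.
move=> /(_ x xab _ d20)[r r0 Hr].
(* [x] may be an endpoint, so the interval lies on one side of [x], the one with room in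
   [[a, b]]. *)
have [c [d [cd cdab cdr]]] : exists c d, [/\ c < d, a <= c /\ d <= b &
    forall y, c < y < d -> `|y - x| < r].
  pose t := Num.min r ((b - a) / 2).
  have t0 : 0 < t by rewrite lt_min r0; lra.
  have tr : t <= r by rewrite ge_min lexx.
  have tb : t <= (b - a) / 2 by rewrite ge_min lexx orbT.
  have [xm|xm] := leP x ((a + b) / 2).
    by exists x, (x + t); split; [lra|split; lra|move=> y ?; rewrite gtr0_norm; lra].
  exists (x - t), x; split; [lra|split; lra|move=> y ?].
  by rewrite distrC gtr0_norm; lra.
(* If [f] and [g] agreed at [y], their difference would have changed by [|f x - g x|], although
   continuity allows only half of that. *)
have sub : `]c, d[ `<=` N.
  move=> y /=; rewrite in_itv/= => ycd; apply: subN => /= Hy.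
  have yab : a <= y <= b by lra.
  have := Hr y yab (cdr y ycd); rewrite Hy ?in_itv//.
    rewrite !mulN1r subrr sub0r normrN.
    by move=> ?; lra.
have : ((d - c)%:E <= 0)%E.
  rewrite -N0 (_ : (d - c)%:E = @lebesgue_measure R `]c, d[).
    by apply: le_measure; rewrite ?inE.
  by rewrite lebesgue_measure_itv/= lte_fin cd EFinB.
by rewrite lee_fin; lra.
Qed.

(** * The random transfer operators *)

Section transfer_operator.
Context (R : realType) (a b : R) (d : measure_display) (Omega : measurableType d).
Context (active : nat -> Omega -> bool) (g dg : nat -> Omega -> R -> R).
Context (P : R -> probability Omega R) (V : set R).
Hypothesis ab : a < b.
Hypothesis oV : open V.
Hypothesis V0 : V 0.
Hypothesis gab : forall z w x, active z w -> a <= x <= b -> a <= g z w x <= b.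
Hypothesis B2 : forall Phi dPhi : R -> R, isC1 a b Phi dPhi ->
  exists dX : nat -> R -> R -> R,
  [/\ forall z eps x, V eps -> a <= x <= b ->
        (P eps).-integrable setT
           (fun w => (bterm active g dg Phi z w x)%:E) /\
        has_deriv_in a b (psi active g dg P Phi z eps) x (dX z eps x),
      forall z,
        {within V `*` `[a, b]%classic,
           continuous (fun p => psi active g dg P Phi z p.1 p.2)} /\
        {within V `*` `[a, b]%classic, continuous (fun p => dX z p.1 p.2)},
      (\sum_(0 <= z <oo) ereal_sup [set (`|psi active g dg P Phi z eps x|)%:E
          | eps in V & x in `[a, b]%classic] < +oo)%E &
      (\sum_(0 <= z <oo) ereal_sup [set (`|dX z eps x|)%:E
          | eps in V & x in `[a, b]%classic] < +oo)%E].

Let V_neq0 : V !=set0. Proof. by exists 0. Qed.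
Let ab_neq0 : `[a, b]%classic !=set0.
Proof. by exists a; rewrite /= in_itv/= lexx ltW. Qed.
Let itvP x : a <= x <= b -> `[a, b]%classic x. Proof. by rewrite /= in_itv. Qed.

Lemma V_ball : exists2 r, 0 < r & forall e, `|e| < r -> V e.
Proof.
have [s /= s0 Hs] := (nbhs_ballP _ _).1 (open_nbhs_nbhs (conj oV V0)).
by exists s => // t ts; apply: Hs; rewrite /ball /= sub0r normrN.
Qed.

Lemma bterm_integrable f df z e x : isC1 a b f df -> V e -> a <= x <= b ->
  (P e).-integrable setT (EFin \o (fun w => bterm active g dg f z w x)).
Proof. by move=> /B2[dX [H _ _ _]] Ve xab; have [] := H z e x Ve xab. Qed.

Lemma bterm_le f K z w x : (forall y, a <= y <= b -> `|f y| <= K) -> a <= x <= b ->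
  `|bterm active g dg f z w x| <= bterm active g dg (fun=> K) z w x.
Proof.
move=> fK xab; rewrite /bterm; case: ifP => [act|_]; last by rewrite normr0.
by rewrite normrM normr_id ler_wpM2r// fK// gab.
Qed.

Lemma psi_cvgn f df e x : isC1 a b f df -> V e -> a <= x <= b ->
  cvgn (series (fun z => psi active g dg P f z e x)).
Proof.
move=> /B2[dX [_ _ S _]] Ve xab.
have [m [_ cm Hm]] := ereal_sup_majorant _ _ _ _ V_neq0 ab_neq0 S.
by apply: (majorant_cvgn _ m) => // z; apply: Hm => //; exact: itvP.
Qed.

Lemma LP_series f df e x : isC1 a b f df -> V e -> a <= x <= b ->
  LP active g dg (P e) f x = limn (series (fun z => psi active g dg P f z e x)).
Proof.
move=> fC Ve xab; have [K _ HK] := isC1_bounded _ _ _ _ _ ab fC.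
have KC := isC1_cst _ a b K.
apply: (Rintegral_limn_series _ _ _ _ (fun z w => bterm active g dg f z w x)
  (fun z w => bterm active g dg (fun=> K) z w x)).
- by move=> z; exact: bterm_integrable fC Ve xab.
- by move=> z; exact: bterm_integrable KC Ve xab.
- by move=> z w; apply: bterm_le => // y /HK[].
- exact: psi_cvgn KC Ve xab.
Qed.

(** Linearity is proved on the series of the [psi], which converge everywhere on [[a, b]]. For a
    given [w] the series of branch terms is not known to converge, and [limn] is linear only on
    convergent series. *)
Lemma LP_lin e f df k dk c : V e -> isC1 a b f df -> isC1 a b k dk ->
  forall x, a <= x <= b -> LP active g dg (P e) (fun y => f y + c * k y) x =
    LP active g dg (P e) f x + c * LP active g dg (P e) k x.
Proof.
move=> Ve fC kC x xab.
rewrite (LP_series _ _ _ _ (isC1_lin _ _ _ c _ _ _ _ fC kC) Ve xab).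
rewrite (LP_series _ _ _ _ fC Ve xab) (LP_series _ _ _ _ kC Ve xab).
rewrite -limn_series_lin; [|exact: psi_cvgn fC Ve xab|exact: psi_cvgn kC Ve xab].
congr (limn (series _)); apply/funext => z; rewrite /psi.
have fi := bterm_integrable _ _ z _ _ fC Ve xab.
have ki := bterm_integrable _ _ z _ _ kC Ve xab.
rewrite -RintegralZl// -RintegralD//; last exact: (integrableZl _ c ki).
apply: eq_Rintegral => w _; rewrite /bterm; case: ifP => _; last by rewrite mulr0 addr0.
by rewrite mulrDl mulrA.
Qed.

(** The terms [bterm] are positive in [Phi], so everything reduces to the constant function 1: [M]
    is the sum of its majorants from (B2), which are uniform in [e]. *)
Lemma LP_bounded : exists2 M, 0 <= M & forall e f df K, V e -> isC1 a b f df ->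
  (forall x, a <= x <= b -> `|f x| <= K) ->
  forall x, a <= x <= b -> `|LP active g dg (P e) f x| <= M * K.
Proof.
have oneC := isC1_cst _ a b 1; have [dX [_ _ S _]] := B2 _ _ oneC.
have [m [m0 cm Hm]] := ereal_sup_majorant _ _ _ _ V_neq0 ab_neq0 S.
exists (limn (series m)).
  by apply: limr_ge => //; apply: nearW => n; exact: sumr_ge0.
move=> e f df K Ve fC fK x xab.
have K0 : 0 <= K by exact: le_trans (fK x xab).
rewrite (LP_series _ _ _ _ fC Ve xab) mulrC -[_ * _](lim_seriesZ K cm).
apply: limn_series_norm_le; last exact: is_cvg_seriesZ.
move=> z; have fi := bterm_integrable _ _ z _ _ fC Ve xab.
have oi := bterm_integrable _ _ z _ _ oneC Ve xab.
apply: (le_trans (le_normr_Rintegral _ fi)) => //.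
apply: (@le_trans _ _ (K * psi active g dg P (fun=> 1) z e x)); last first.
  by rewrite ler_wpM2l//; apply: le_trans (ler_norm _) _; apply: Hm => //; exact: itvP.
rewrite -RintegralZl//; apply: le_Rintegral => //.
- exact: integrable_norm fi.
- exact: (integrableZl _ K oi).
- move=> w _; apply: le_trans (bterm_le _ _ z w x fK xab) _.
  by rewrite /bterm; case: ifP; rewrite ?mulr0// mul1r.
Qed.

Lemma LP_C1 f df : isC1 a b f df -> exists dL : R -> R -> R,
  (forall e, V e -> isC1 a b (LP active g dg (P e) f) (dL e)) /\
  forall eta, 0 < eta -> exists2 r, 0 < r & forall e, `|e| < r -> V e /\
    forall x, a <= x <= b ->
      `|LP active g dg (P e) f x - LP active g dg (P 0) f x| <= eta /\
      `|dL e x - dL 0 x| <= eta.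
Proof.
move=> fC; have [dX [D C S dS]] := B2 _ _ fC.
have [m [_ cm Hm]] := ereal_sup_majorant _ _ _ _ V_neq0 ab_neq0 S.
have [dm [_ cdm Hdm]] := ereal_sup_majorant _ _ _ _ V_neq0 ab_neq0 dS.
have [r0 r00 Hr0] := V_ball.
exists (fun e x => limn (series (fun z => dX z e x))); split.
  move=> e Ve.
  have H : isC1 a b (fun x => limn (series (fun z => psi active g dg P f z e x)))
    (fun x => limn (series (fun z => dX z e x))).
    apply: (isC1_series _ _ _ _ _ m dm) => //.
    - move=> z; split; first by move=> x xab; have [] := D z e x Ve xab.
      exact: slice_continuous (C z).2 _ Ve.
    - by move=> z x xab; apply: Hm => //; exact: itvP.
    - by move=> z x xab; apply: Hdm => //; exact: itvP.
  by apply: isC1_ext H => // x xab; rewrite (LP_series _ _ _ _ fC Ve xab).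
have unif (F : nat -> R -> R -> R) (n : nat -> R) : cvgn (series n) ->
    (forall z e x, V e -> `[a, b]%classic x -> `|F z e x| <= n z) ->
    (forall z, {within V `*` `[a, b]%classic, continuous (fun p => F z p.1 p.2)}) ->
    forall eta, 0 < eta -> exists2 r, 0 < r & forall e, `|e| < r -> V e ->
    forall x, a <= x <= b ->
    `|limn (series (fun z => F z e x)) - limn (series (fun z => F z 0 x))| <= eta.
  move=> cn Hn CF; apply: (series_uniform _ _ _ r0 _ _ _ n) => //.
  - by move=> z t x _ Vt xab; apply: Hn => //; exact: itvP.
  - by move=> z x xab; apply: Hn => //; exact: itvP.
  - move=> z eta /(slice_uniform _ _ _ _ _ (CF z) oV V0)[r r_0 Hr].
    by exists r => // t tr _ x xab; have [_ ->] := Hr t tr.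
move=> eta eta0.
have [r r_0 Hr] := unif _ _ cm Hm (fun z => (C z).1) _ eta0.
have [s s0 Hs] := unif _ _ cdm Hdm (fun z => (C z).2) _ eta0.
exists (Num.min r0 (Num.min r s)); first by rewrite !lt_min r00 r_0.
move=> e; rewrite !lt_min => /andP[/Hr0 Ve /andP[er es]]; split=> // x xab; split.
  by rewrite (LP_series _ _ _ _ fC Ve xab) (LP_series _ _ _ _ fC V0 xab); exact: Hr.
exact: Hs.
Qed.

Lemma LP_quotient f df (dE dX dEX : nat -> R -> R -> R) : isC1 a b f df ->
  (forall z e x, V e -> a <= x <= b ->
    [/\ is_derive e (1 : R) (fun e' => psi active g dg P f z e' x) (dE z e x),
        has_deriv_in a b (psi active g dg P f z e) x (dX z e x) &
        is_derive e (1 : R) (fun e' => dX z e' x) (dEX z e x)]) ->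
  (forall z, {within V `*` `[a, b]%classic, continuous (fun p => dE z p.1 p.2)}) ->
  (forall z, {within V `*` `[a, b]%classic, continuous (fun p => dEX z p.1 p.2)}) ->
  (\sum_(0 <= z <oo) ereal_sup [set (`|dE z e x|)%:E
      | e in V & x in `[a, b]%classic] < +oo)%E ->
  (\sum_(0 <= z <oo) ereal_sup [set (`|dEX z e x|)%:E
      | e in V & x in `[a, b]%classic] < +oo)%E ->
  exists dL : R -> R -> R, (forall e, V e -> isC1 a b (LP active g dg (P e) f) (dL e)) /\
  forall eta, 0 < eta -> exists2 r, 0 < r & forall e, `|e| < r -> e != 0 ->
    forall x, a <= x <= b ->
    `|(LP active g dg (P e) f x - LP active g dg (P 0) f x) / e
        - limn (series (fun z => dE z 0 x))| <= eta /\
    `|(dL e x - dL 0 x) / e - limn (series (fun z => dEX z 0 x))| <= eta.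
Proof.
move=> fC D cE cEX SE SEX; have [dX' [D' C S dS]] := B2 _ _ fC.
(* The derivatives supplied by (B1) and by (B2) are separate witnesses for the same [psi].
   Identifying them transfers the summability and continuity of [dX'] to [dX], whose parameter
   derivative is [dEX]. *)
have dXE z e x : V e -> a <= x <= b -> dX z e x = dX' z e x.
  move=> Ve xab; have [_ H1 _] := D z e x Ve xab; have [_ H2] := D' z e x Ve xab.
  exact: has_deriv_in_uniq H1 H2.
have [m [_ cm Hm]] := ereal_sup_majorant _ _ _ _ V_neq0 ab_neq0 S.
have [dm [_ cdm Hdm']] := ereal_sup_majorant _ _ _ _ V_neq0 ab_neq0 dS.
have Hdm z e x : V e -> a <= x <= b -> `|dX z e x| <= dm z.
  by move=> Ve xab; rewrite dXE//; apply: Hdm' => //; exact: itvP.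
have [mE [_ cmE HmE]] := ereal_sup_majorant _ _ _ _ V_neq0 ab_neq0 SE.
have [mX [_ cmX HmX]] := ereal_sup_majorant _ _ _ _ V_neq0 ab_neq0 SEX.
have [r0 r00 Hr0] := V_ball.
(* Used twice: for [psi] with [dE], and for [dX] with [dEX]. The second gives the quotients of the
   [x]-derivative of the operator. *)
have unif (F FE : nat -> R -> R -> R) (n : nat -> R) : cvgn (series n) ->
    (forall z e x, V e -> `[a, b]%classic x -> `|FE z e x| <= n z) ->
    (forall z, {within V `*` `[a, b]%classic, continuous (fun p => FE z p.1 p.2)}) ->
    (forall z e x, V e -> a <= x <= b -> is_derive e (1 : R) (fun e' => F z e' x) (FE z e x)) ->
    (forall e x, V e -> a <= x <= b -> cvgn (series (fun z => F z e x))) ->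
    forall eta, 0 < eta -> exists2 r, 0 < r & forall e, `|e| < r -> e != 0 ->
    forall x, a <= x <= b ->
    `|(limn (series (fun z => F z e x)) - limn (series (fun z => F z 0 x))) / e
      - limn (series (fun z => FE z 0 x))| <= eta.
  move=> cn Hn CF DF cF eta eta0.
  have Q z := quotient_uniform _ a b r0 (n z) (F z) (FE z) r00.
  have {}Q z : (forall t x, `|t| < r0 -> t != 0 -> a <= x <= b ->
        `|(F z t x - F z 0 x) / t| <= n z) /\
      forall eta, 0 < eta -> exists2 r, 0 < r & forall t, `|t| < r -> t != 0 ->
        forall x, a <= x <= b -> `|(F z t x - F z 0 x) / t - FE z 0 x| <= eta.
    apply: Q.
    - by move=> t x /Hr0 Vt xab; exact: DF.
    - by move=> t x /Hr0 Vt xab; apply: Hn => //; exact: itvP.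
    - move=> eta' /(slice_uniform _ _ _ _ _ (CF z) oV V0)[r r_0 Hr].
      by exists r => // t tr x xab; have [_ ->] := Hr t tr.
  have [r r_0 Hr] := series_uniform _ a b r0 [set t | t != 0]
    (fun z t x => (F z t x - F z 0 x) / t) (fun z x => FE z 0 x) n r00 cn
    (fun z => (Q z).1) (fun z x xab => Hn z 0 x V0 (itvP _ xab)) (fun z => (Q z).2) _ eta0.
  exists (Num.min r r0); first by rewrite lt_min r_0.
  move=> t; rewrite lt_min => /andP[tr /Hr0 Vt] t0 x xab.
  by rewrite -limn_series_sub_div; [exact: Hr|exact: cF|exact: cF].
exists (fun e x => limn (series (fun z => dX z e x))); split.
  move=> e Ve.
  have H : isC1 a b (fun x => limn (series (fun z => psi active g dg P f z e x)))
    (fun x => limn (series (fun z => dX z e x))).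
    apply: (isC1_series _ _ _ _ _ m dm) => //.
    - move=> z; apply: (isC1_ext _ _ _ _ (dX' z e)) => //.
        by move=> x xab; rewrite dXE.
      split; first by move=> x xab; have [] := D' z e x Ve xab.
      exact: slice_continuous (C z).2 _ Ve.
    - by move=> z x xab; apply: Hm => //; exact: itvP.
    - by move=> z x xab; exact: Hdm.
  by apply: isC1_ext H => // x xab; rewrite (LP_series _ _ _ _ fC Ve xab).
move=> eta eta0.
have [||r r_0 Hr] := unif (fun z e x => psi active g dg P f z e x) dE _ cmE HmE cE _ _ _ eta0.
- by move=> z e x Ve xab; have [] := D z e x Ve xab.
- by move=> e x Ve xab; exact: psi_cvgn fC Ve xab.
have [||s s0 Hs] := unif dX dEX _ cmX HmX cEX _ _ _ eta0.
- by move=> z e x Ve xab; have [] := D z e x Ve xab.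
- by move=> e x Ve xab; apply: majorant_cvgn cdm => z; exact: Hdm.
exists (Num.min r0 (Num.min r s)); first by rewrite !lt_min r00 r_0.
move=> e; rewrite !lt_min => /andP[/Hr0 Ve /andP[er es]] e0 x xab; split.
  by rewrite (LP_series _ _ _ _ fC Ve xab) (LP_series _ _ _ _ fC V0 xab); exact: Hr.
exact: Hs.
Qed.

End transfer_operator.

(** * Verification of the abstract hypotheses and conclusion *)

Theorem theorem2p3 (R : realType) (a b : R) (d : measure_display)
  (Omega : measurableType d)
  (T : Omega -> R -> R) (active : nat -> Omega -> bool) (lo hi : nat -> Omega -> R)
  (g dg : nat -> Omega -> R -> R)
  (P : R -> probability Omega R) (V : set R)
  (h dh d2h : R -> R -> R) :
  a < b ->
  branch_system a b T active lo hi g dg ->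
  open V -> V 0 ->
  (* (B) uniform spectral gap of L_{P_eps} on C^1(X) *)
  (exists (theta C : R), 0 < theta < 1 /\ 0 < C /\
     forall eps, V eps ->
     forall phi dphi : R -> R, isC1 a b phi dphi -> mint a b phi = 0 ->
     forall n : nat, (1 <= n)%N ->
       exists dpsi : R -> R,
         isC1 a b (iter n (LP active g dg (P eps)) phi) dpsi /\
         C1norm a b (iter n (LP active g dg (P eps)) phi) dpsi
           <= C * theta ^+ n * C1norm a b phi dphi) ->
  (* (B) unique stationary density h_eps in C^2(X) *)
  (forall eps, V eps ->
     [/\ isC1 a b (h eps) (dh eps), isC1 a b (dh eps) (d2h eps),
         (forall x, a <= x <= b -> 0 <= h eps x),
         mint a b (h eps) = 1 &
         {ae @lebesgue_measure R, forall x, x \in `[a, b] ->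
            LP active g dg (P eps) (h eps) x = h eps x}]) ->
  (forall eps, V eps ->
     forall h' : R -> R,
       measurable_fun `[a, b] h' ->
       (@lebesgue_measure R).-integrable `[a, b] (fun x => (h' x)%:E) ->
       {ae @lebesgue_measure R, forall x, x \in `[a, b] -> 0 <= h' x} ->
       mint a b h' = 1 ->
       {ae @lebesgue_measure R, forall x, x \in `[a, b] ->
            LP active g dg (P eps) h' x = h' x} ->
       {ae @lebesgue_measure R, forall x, x \in `[a, b] -> h' x = h eps x}) ->
  (* (B1) for Phi = h_0 *)
  (exists dE dX dXE dEX : nat -> R -> R -> R,
     [/\ forall z eps x, V eps -> a <= x <= b ->
           [/\ is_derive eps (1:R) (fun e => psi active g dg P (h 0) z e x) (dE z eps x),
               has_deriv_in a b (psi active g dg P (h 0) z eps) x (dX z eps x),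
               has_deriv_in a b (dE z eps) x (dXE z eps x) &
               is_derive eps (1:R) (fun e => dX z e x) (dEX z eps x)],
         forall z,
           [/\ {within V `*` `[a, b]%classic, continuous (fun p => dE z p.1 p.2)},
               {within V `*` `[a, b]%classic, continuous (fun p => dX z p.1 p.2)},
               {within V `*` `[a, b]%classic, continuous (fun p => dXE z p.1 p.2)} &
               {within V `*` `[a, b]%classic, continuous (fun p => dEX z p.1 p.2)}],
         (\sum_(0 <= z <oo) ereal_sup [set (`|dE z eps x|)%:E
             | eps in V & x in `[a, b]%classic] < +oo)%E &
         (\sum_(0 <= z <oo) ereal_sup [set (`|dEX z eps x|)%:E
             | eps in V & x in `[a, b]%classic] < +oo)%E]) ->
  (* (B2) for every Phi in C^1(X) *)
  (forall Phi dPhi : R -> R, isC1 a b Phi dPhi ->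
     exists dX : nat -> R -> R -> R,
     [/\ forall z eps x, V eps -> a <= x <= b ->
           (P eps).-integrable setT
              (fun w => (bterm active g dg Phi z w x)%:E) /\
           has_deriv_in a b (psi active g dg P Phi z eps) x (dX z eps x),
         forall z,
           {within V `*` `[a, b]%classic,
              continuous (fun p => psi active g dg P Phi z p.1 p.2)} /\
           {within V `*` `[a, b]%classic, continuous (fun p => dX z p.1 p.2)},
         (\sum_(0 <= z <oo) ereal_sup [set (`|psi active g dg P Phi z eps x|)%:E
             | eps in V & x in `[a, b]%classic] < +oo)%E &
         (\sum_(0 <= z <oo) ereal_sup [set (`|dX z eps x|)%:E
             | eps in V & x in `[a, b]%classic] < +oo)%E]) ->
  (* conclusion *)
  exists hs dhs D dD : R -> R,
    [/\ isC1 a b hs dhs,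
        (fun eps => C1norm a b
            (fun x => (h eps x - h 0 x) / eps - hs x)
            (fun x => (dh eps x - dh 0 x) / eps - dhs x)) @ 0^' --> 0,
        (* hs = (I - L_{P_0})^{-1} D on zero-average C^1 functions *)
        [/\ isC1 a b D dD, mint a b D = 0, mint a b hs = 0 &
            forall x, a <= x <= b -> hs x - LP active g dg (P 0) hs x = D x],
        (* D = d/d eps L_{P_eps} h_0 at eps = 0 *)
        (forall x, a <= x <= b ->
           is_derive (0:R) (1:R) (fun e => LP active g dg (P e) (h 0) x) (D x)) &
        (* D = d/d eps sum_z int_Omega [h_0 o g |g'|] dP_eps at eps = 0 *)
        (forall x, a <= x <= b ->
           is_derive (0:R) (1:R) (fun e => limn (fun n =>
                \sum_(0 <= z < n) psi active g dg P (h 0) z e x)) (D x))].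
Proof.
move=> ab bs oV V0 [theta [C [theta01 [C0 gap]]]] stat _ [dE [dX [dXE [dEX [DB1 CB1 SE SEX]]]]] B2.
have gab z w x : active z w -> a <= x <= b -> a <= g z w x <= b.
  move=> act xab; have [_ lohi _ _ br] := bs w.
  have [alo [_ hib]] := lohi z act; have [_ _ /(_ x xab) gx _ _] := br z act.
  lra.
have hC e : V e -> isC1 a b (h e) (dh e) by move=> /stat[].
have hint e : V e -> mint a b (h e) = 1 by move=> /stat[].
have LC1 := LP_C1 _ _ _ _ _ _ _ _ _ _ ab oV V0 gab B2.
(* Both sides are continuous on [[a, b]], so equality almost everywhere is equality everywhere. *)
have hstat e : V e -> forall x, a <= x <= b -> LP active g dg (P e) (h e) x = h e x.
  move=> Ve; have [_ _ _ _ ae] := stat e Ve; have [dL [LC _]] := LC1 _ _ (hC e Ve).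
  exact: within_itv_continuous_ae_eq ab (isC1_cont _ _ _ _ _ (LC e Ve))
    (isC1_cont _ _ _ _ _ (hC e Ve)) ae.
have [M M0 LM] := LP_bounded _ _ _ _ _ _ _ _ _ _ ab V0 gab B2.
have h0C := hC 0 V0.
pose D x := limn (series (fun z => dE z 0 x)).
pose dD x := limn (series (fun z => dEX z 0 x)).
have [|z|z|dL0 [L0C quot]] := LP_quotient _ _ _ _ _ _ _ _ _ _ ab oV V0 gab B2
    (h 0) (dh 0) dE dX dEX h0C _ _ _ SE SEX.
- by move=> z e x Ve xab; have [? ? _ ?] := DB1 z e x Ve xab.
- by have [] := CB1 z.
- by have [] := CB1 z.
have [hs [dhs [hsC hsl [DC D0 hs0 hsE]]]] :=
  linear_response _ _ _ V (fun e => LP active g dg (P e)) M theta C h dh ab V0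
    (LP_lin _ _ _ _ _ _ _ _ _ _ ab V0 gab B2) LM M0 LC1 theta01 C0 gap hC hint hstat
    D dD dL0 L0C quot.
have [r0 r00 Hr0] := V_ball _ _ oV V0.
(* Both derivative formulas are instances: [F] is the operator itself or the series of the [psi],
   which agrees with it only for parameters in [V]. A ball inside [V] suffices for a derivative at
   0. *)
have DD (F : R -> R) x : a <= x <= b ->
    (forall e, V e -> F e = LP active g dg (P e) (h 0) x) ->
    is_derive (0 : R) (1 : R) F (D x).
  move=> xab FE; apply/is_derive1P => eta /quot[r r_0 Hr].
  exists (Num.min r r0); first by rewrite lt_min r_0.
  move=> e; rewrite subr0 lt_min => /andP[er /Hr0 Ve].
  rewrite !FE//; have [->|e0] := eqVneq e 0; first by rewrite mulr0 subrr subr0 normr0 mulr0.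
  have [H _] := Hr e er e0 x xab.
  by move: H; rewrite -(ler_pM2r (_ : 0 < `|e|)) ?normr_gt0// -normrM mulrBl divfK.
exists hs, dhs, D, dD; split => // x xab; apply: DD => // e Ve.
by rewrite (LP_series _ _ _ _ _ _ _ _ _ _ ab V0 gab B2 _ _ _ _ h0C Ve xab).
Qed.
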